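(* The fractional Laplacian $(-\Delta)^\alpha$ on $\mathbb{Z}$ exhibits super-ballistic motion for any $0<\alpha\le\frac14$. More precisely, $\|x\,e^{it(-\Delta)^\alpha}\delta_0\|=\infty$ for every $t\neq 0$.
   Context: On $\ell^2(\mathbb{Z})$, $(-\Delta f)(n)=2f(n)-f(n-1)-f(n+1)$, and $(-\Delta)^\alpha$ is defined by functional calculus of this non-negative bounded self-adjoint operator. $(x\psi)(n):=n\psi(n)$ for $n\in\mathbb{Z}$, and $\|x\psi\|=\big(\sum_n n^2|\psi(n)|^2\big)^{1/2}\in[0,\infty]$. $\delta_0$ is the indicator of $\{0\}$. *)

(* Defs.v *)
From HB Require Import structures.
From mathcomp Require Import all_boot all_order all_algebra.
From mathcomp Require Import all_classical all_reals all_analysis.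
From mathcomp Require Import complex ring.

Set Implicit Arguments.
Unset Strict Implicit.
Unset Printing Implicit Defensive.

Import Order.TTheory GRing.Theory Num.Theory.
Import numFieldNormedType.Exports.
Import Normc.

Local Open Scope classical_set_scope.
Local Open Scope ring_scope.
Local Open Scope complex_scope.

Section SquareSummable.
Variable R : realType.
Implicit Types f g : int -> R[i].

(* [normc z : R] is the modulus of [z : R[i]]. The l2 norm of an arbitrary
   sequence lives in [0, +oo]. *)
Definition sqnorm f : \bar R :=
  (\esum_(n in [set: int]) ((normc (f n)) ^+ 2)%:E)%E.

Definition enorm f : \bar R := sqrte (sqnorm f).

Definition square_summable : {pred int -> R[i]} :=
  mem [set f | (enorm f < +oo)%E].

Lemma normc_ge0 (z : R[i]) : 0 <= normc z.
Proof. by case: z => a b; exact: sqrtr_ge0. Qed.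

Lemma sqnorm_ge0 f : (0 <= sqnorm f)%E.
Proof. by apply: esum_ge0 => n _; rewrite lee_fin sqr_ge0. Qed.

Lemma square_summableE f : (f \in square_summable) = (sqnorm f < +oo)%E.
Proof.
rewrite [LHS](_ : _ = (enorm f < +oo)%E); last by apply/idP/idP; rewrite inE.
by rewrite /enorm; case: (sqnorm f) (sqnorm_ge0 f) => //= r _; rewrite !ltry.
Qed.

Lemma sqnorm_shift f (k : int) : sqnorm (fun n => f (n + k)) = sqnorm f.
Proof.
rewrite /sqnorm [RHS](@reindex_esum _ _ _ [set: int] [set: int] (+%R^~ k))//.
rewrite setTT_bijective.
by exists (fun n => n - k) => n /=; rewrite ?addrK ?subrK.
Qed.

Lemma square_summable_shift f (k : int) : f \in square_summable ->
  (fun n => f (n + k)) \in square_summable.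
Proof. by rewrite !square_summableE sqnorm_shift. Qed.

Lemma square_summableD f g : f \in square_summable -> g \in square_summable ->
  f + g \in square_summable.
Proof.
rewrite !square_summableE => f2 g2.
pose F n : \bar R := ((normc (f n)) ^+ 2)%:E.
pose G n : \bar R := ((normc (g n)) ^+ 2)%:E.
have F0 n : (0 <= F n)%E by rewrite lee_fin sqr_ge0.
have G0 n : (0 <= G n)%E by rewrite lee_fin sqr_ge0.
apply: (@le_lt_trans _ _
    (\esum_(n in [set: int]) ((F n + F n) + (G n + G n)))%E).
  apply: le_esum => n _; rewrite -!EFinD lee_fin.
  rewrite [(f + g) n]/(f n + g n).
  apply: (@le_trans _ _ ((normc (f n) + normc (g n)) ^+ 2)).
    by rewrite ler_sqr ?nnegrE ?addr_ge0 ?normc_ge0//; exact: le_normcD.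
  set a := normc _; set b := normc _.
  rewrite -subr_ge0 (_ : _ - _ = (a - b) ^+ 2) ?sqr_ge0//; ring.
by rewrite !esumD// ?lte_add_pinfty// => n _; rewrite adde_ge0.
Qed.

Lemma square_summableZ (c : R[i]) f : f \in square_summable ->
  c *: f \in square_summable.
Proof.
rewrite !square_summableE => f2.
apply: (@le_lt_trans _ _ (((normc c) ^+ 2)%:E * sqnorm f)%E); last first.
  by rewrite lte_mul_pinfty// lee_fin sqr_ge0.
apply: ge_ereal_sup => _ [X [finX _] <-].
rewrite (eq_fsbigr (fun n => ((normc c) ^+ 2)%:E * ((normc (f n)) ^+ 2)%:E)%E);
  last by move=> n _; rewrite -EFinM -exprMn -normcM.
rewrite -ge0_mule_fsumr; last by move=> n; rewrite lee_fin sqr_ge0.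
apply: lee_wpmul2l; first by rewrite lee_fin sqr_ge0.
by apply: esum_ge; exists X.
Qed.

Lemma square_summable0 : (0 : int -> R[i]) \in square_summable.
Proof.
rewrite square_summableE /sqnorm esum1// => n _.
by rewrite [(0 : int -> R[i]) n]/(0 : R[i]) normc0 expr0n.
Qed.

Lemma square_summable_submod : submod_closed square_summable.
Proof.
split; first exact: square_summable0.
by move=> c f g f2 g2; rewrite square_summableD// square_summableZ.
Qed.

HB.instance Definition _ :=
  GRing.isSubmodClosed.Build _ _ square_summable square_summable_submod.

End SquareSummable.

Section Ell2.
Variable R : realType.

Record ell2 := Ell2 {
  ell2_fun :> int -> R[i];
  ell2P : ell2_fun \in @square_summable R
}.

HB.instance Definition _ := [isSub for ell2_fun].
HB.instance Definition _ := [Choice of ell2 by <:].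
HB.instance Definition _ := [SubChoice_isSubLmodule of ell2 by <:].

Lemma neg_laplacian_subproof (f : ell2) :
  (fun n => 2 * f n - f (n - 1) - f (n + 1)) \in @square_summable R.
Proof.
rewrite (_ : (fun n => _) = 2 *: (f : int -> R[i]) -
  (fun n => f (n - 1)) - (fun n => f (n + 1)))//.
by rewrite !rpredB ?rpredZ ?square_summable_shift//; exact: ell2P.
Qed.

Definition neg_laplacian (f : ell2) : ell2 := Ell2 (neg_laplacian_subproof f).

Lemma delta_subproof (k : int) :
  (fun n : int => (n == k)%:R : R[i]) \in @square_summable R.
Proof.
rewrite square_summableE /sqnorm.
rewrite (eq_esum (b := fun n => if n \in [set k] then 1%:E else 0%E)).
  by rewrite -esum_mkcond esum_set1 ?ltry// lee_fin.
move=> n _; case: eqVneq => [->|nk].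
  by rewrite mem_set// [normc _]normc1 expr1n.
by rewrite memNset ?[normc _]normc0 ?expr0n//; exact/eqP.
Qed.

Definition delta (k : int) : ell2 := Ell2 (delta_subproof k).

End Ell2.

Section Operators.
Variable R : realType.
Local Notation E := (ell2 R).
Implicit Types A B : E -> E.

Definition opnorm A : \bar R :=
  ereal_sup [set enorm (A f) | f in [set f : E | (enorm f <= 1)%E]].

Definition bounded_operator A : Prop := linear A /\ (opnorm A < +oo)%E.

Definition op_cvg (T : nat -> E -> E) A : Prop :=
  opnorm (fun f => T n f - A f) @[n --> \oo] --> 0%E.

Definition spectrum A : set R[i] :=
  [set z | ~ exists B, [/\ bounded_operator B,
      cancel (fun f => A f - z *: f) B & cancel B (fun f => A f - z *: f)]].

Definition op_poly (p : {poly R[i]}) A : E -> E :=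
  fun f => \sum_(k < size p) p`_k *: iter k A f.

(* Continuous functional calculus of a bounded self-adjoint operator [A], whose
   spectrum is real: [B = phi(A)] is the norm limit of [p_n(A)] for polynomials
   [p_n] converging to [phi] uniformly on the spectrum of [A]. *)
Definition is_funcalc A (phi : R -> R[i]) B : Prop :=
  bounded_operator B /\
  exists p : nat -> {poly R[i]},
    (forall e : R, 0 < e -> \forall n \near \oo, forall x : R,
        spectrum A x%:C -> normc ((p n).[x%:C] - phi x) < e) /\
    op_cvg (fun n => op_poly (p n) A) B.

(* The default value [0] of [xget] is reached only when [phi(A)] does not
   exist. *)
Definition funcalc A (phi : R -> R[i]) : E -> E :=
  xget (fun=> 0) [set B | is_funcalc A phi B].

Definition is_op_exp A B : Prop :=
  bounded_operator B /\
  op_cvg (fun n f => \sum_(k < n) (k`!%:R)^-1 *: iter k A f) B.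

Definition op_exp A : E -> E := xget (fun=> 0) [set B | is_op_exp A B].

Definition frac_laplacian (alpha : R) : E -> E :=
  funcalc (@neg_laplacian R) (fun x => (x `^ alpha)%:C).

(* e^{itA} *)
Definition propagator (t : R) A : E -> E :=
  op_exp (fun f => (0 +i* t) *: A f).

Definition position (psi : int -> R[i]) : int -> R[i] :=
  fun n => n%:~R * psi n.

End Operators.

(* Main.v *)
From HB Require Import structures.
Require Import Defs.
From mathcomp Require Import all_boot all_order all_algebra.
From mathcomp Require Import all_classical all_reals all_analysis.
From mathcomp Require Import complex ring lra.

(* A square-summable [x psi] would make the Fourier transform of [psi] little-o
   Hoelder of exponent 1/2, because on frequencies [|u| = 1] with [|u - 1| = d]
   one has [|u^m - 1| <= min (2, |m| d)] and
   [sum_m (min (2, |m| d) / m)^2 = O(d)].  But the transform of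
   [e^{itH} delta_0], [H = (-Delta)^alpha], is [exp (it d^(2 alpha))], which
   moves by about [|t| d^(2 alpha) >= |t| d^(1/2)] between [1] and [u].

   No integral is needed: the truncated plane waves [sum_(k < j) u^k delta_k]
   are approximate eigenvectors of [-Delta] with eigenvalue
   [2 - u - 1/u = d^2], hence also of the norm limits of polynomials [H] and
   [e^{itH}]; reading the approximate eigenvalue equation at a single site gives
   a finite partial Fourier sum of [psi] close to the eigenvalue.

   Existence of [H] comes from the binomial series of [x^alpha] in powers of
   [1 - x / 4], whose coefficients are absolutely summable. *)

Set Implicit Arguments.
Unset Strict Implicit.
Unset Printing Implicit Defensive.

Import Order.TTheory GRing.Theory Num.Theory.
Import numFieldNormedType.Exports.
Import Normc.

Local Open Scope classical_set_scope.
Local Open Scope ring_scope.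
Local Open Scope complex_scope.

(** * Square-summable sequences as a normed space *)

Section Norm.
Variable R : realType.
Implicit Types (f g : ell2 R) (h : int -> R[i]).

(** At [alpha = 1/4] the two exponents coincide: the transform moves by about [|t| d^(1/2)], and a
    plain Hoelder bound of order [d^(1/2)] would not contradict this. The little-o is what decides;
    it comes from splitting off finitely many sites that carry almost all of the norm of [x psi], on
    which the transform is Lipschitz. [H] and the propagator are both chosen by [xget], so their
    existence has to be proved first; afterwards only their defining limits are used. The spectrum
    enters twice: it lies in [[0, 4]], where the binomial polynomials converge uniformly, and it
    contains the values [d^2], without which those polynomials would say nothing about
    [d^(2 alpha)]. The eigenvalue [exp (it d^(2 alpha))] is never formed: one fixed partial sum of
    the exponential series is close to the propagator in norm and already differs from [1] by at
    least half its linear term. The partial Fourier sums at [1] and at [u] can be compared only over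
    the same window, so one site has to serve both frequencies. *)

Lemma normc_real (x : R) : normc x%:C = `|x|.
Proof. by rewrite /normc/= expr0n/= addr0 sqrtr_sqr. Qed.

Lemma normcB (z w : R[i]) : normc (z - w) = normc (w - z).
Proof. by rewrite -normcN opprB. Qed.

Lemma normcX (z : R[i]) n : normc (z ^+ n) = normc z ^+ n.
Proof. by elim: n => [|n ih]; rewrite ?expr0 ?normc1// !exprS normcM ih. Qed.

Lemma normc_sqr (z : R[i]) : normc z ^+ 2 = complex.Re z ^+ 2 + complex.Im z ^+ 2.
Proof. by case: z => a b; rewrite /normc/= sqr_sqrtr// addr_ge0 ?sqr_ge0. Qed.

Lemma normc_sum (I : Type) (s : seq I) (F : I -> R[i]) :
  normc (\sum_(i <- s) F i) <= \sum_(i <- s) normc (F i).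
Proof.
elim: s => [|a s ih]; rewrite ?big_nil ?normc0// !big_cons.
by rewrite (le_trans (le_normcD _ _))// lerD2l.
Qed.

Definition nrm f : R := Num.sqrt (fine (sqnorm f)).

Lemma nrm_ge0 f : 0 <= nrm f.
Proof. exact: sqrtr_ge0. Qed.

Lemma sqnormE f : sqnorm f = (nrm f ^+ 2)%:E.
Proof.
have f2 := ell2P f; rewrite square_summableE in f2.
rewrite /nrm sqr_sqrtr ?fine_ge0 ?sqnorm_ge0// fineK//.
by rewrite ge0_fin_numE ?sqnorm_ge0.
Qed.

Lemma enormE f : enorm f = (nrm f)%:E.
Proof. by rewrite /enorm sqnormE/= sqrtr_sqr ger0_norm ?nrm_ge0. Qed.

Lemma sum_le_sqnorm h (s : seq int) : uniq s ->
  ((\sum_(n <- s) normc (h n) ^+ 2)%:E <= sqnorm h)%E.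
Proof.
move=> us; apply: esum_ge; exists [set` s].
  by split=> //; exact: finite_seq.
by rewrite -fsbig_seq// -sumEFin.
Qed.

Lemma sqnorm_leP h (c : R) :
  (forall s : seq int, uniq s -> \sum_(n <- s) normc (h n) ^+ 2 <= c) ->
  (sqnorm h <= c%:E)%E.
Proof.
move=> hc; apply: ge_ereal_sup => _ [X [finX _] <-].
by rewrite fsbig_finite// sumEFin lee_fin hc// finmap.fset_uniq.
Qed.

Lemma sum_le_nrm f (s : seq int) : uniq s ->
  \sum_(n <- s) normc (f n) ^+ 2 <= nrm f ^+ 2.
Proof. by move=> us; rewrite -lee_fin -sqnormE sum_le_sqnorm. Qed.

Lemma nrm_leP f (c : R) : 0 <= c ->
  (forall s : seq int, uniq s -> \sum_(n <- s) normc (f n) ^+ 2 <= c ^+ 2) ->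
  nrm f <= c.
Proof.
move=> c0 hc; rewrite -ler_sqr ?nnegrE ?nrm_ge0// -lee_fin -sqnormE.
exact: sqnorm_leP.
Qed.

Lemma normc_le_nrm f n : normc (f n) <= nrm f.
Proof.
rewrite -ler_sqr ?nnegrE ?nrm_ge0 ?normc_ge0//.
by have := @sum_le_nrm f [:: n]; rewrite big_seq1; apply.
Qed.

Lemma nrmZ (c : R[i]) f : nrm (c *: f) = normc c * nrm f.
Proof.
have le (d : R[i]) (g : ell2 R) : nrm (d *: g) <= normc d * nrm g.
  apply: nrm_leP => [|s us]; first by rewrite mulr_ge0 ?normc_ge0 ?nrm_ge0.
  rewrite exprMn; under eq_bigr do rewrite [normc _]normcM exprMn.
  by rewrite -mulr_sumr ler_wpM2l ?sqr_ge0 ?sum_le_nrm.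
apply/eqP; rewrite eq_le le/=.
have [->|c0] := eqVneq c 0; first by rewrite [normc _]normc0 mul0r nrm_ge0.
have nc0 : 0 < normc c.
  by rewrite lt_neqAle normc_ge0 eq_sym andbT; apply: contra c0 => /eqP/eq0_normc/eqP.
rewrite -ler_pdivlMl//.
have := le c^-1 (c *: f).
by rewrite scalerA mulVf// scale1r normcV.
Qed.

Lemma nrmN f : nrm (- f) = nrm f.
Proof. by rewrite -scaleN1r nrmZ normcN [normc _]normc1 mul1r. Qed.

Lemma nrm0 : nrm 0 = 0.
Proof. by rewrite -(scale0r (0 : ell2 R)) nrmZ [normc _]normc0 mul0r. Qed.

Lemma nrmB f g : nrm (f - g) = nrm (g - f).
Proof. by rewrite -nrmN opprB. Qed.

Lemma nrm_eq0 f : nrm f = 0 -> f = 0.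
Proof.
move=> f0; apply: val_inj; apply/funext => n /=.
by apply: eq0_normc; apply/le_anti; rewrite normc_ge0 -f0 normc_le_nrm.
Qed.

(* With [a = nrm f] and [b = nrm g], expand
   [|z + w|^2 <= (1 + b / a) |z|^2 + (1 + a / b) |w|^2] and sum. *)
Lemma nrmD f g : nrm (f + g) <= nrm f + nrm g.
Proof.
have [f0|f0] := eqVneq (nrm f) 0.
  by rewrite f0 (nrm_eq0 f0) !add0r.
have [g0|g0] := eqVneq (nrm g) 0.
  by rewrite g0 (nrm_eq0 g0) !addr0.
have a0 : 0 < nrm f by rewrite lt_neqAle eq_sym f0 nrm_ge0.
have b0 : 0 < nrm g by rewrite lt_neqAle eq_sym g0 nrm_ge0.
set a := nrm f in a0 f0 *; set b := nrm g in b0 g0 *.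
apply: nrm_leP => [|s us]; first by rewrite addr_ge0 ?ltW.
have -> : (a + b) ^+ 2 = (1 + b / a) * a ^+ 2 + (1 + a / b) * b ^+ 2.
  by field; rewrite f0 g0.
have F := sum_le_nrm f us; have G := sum_le_nrm g us.
have ca : 0 <= 1 + b / a by rewrite addr_ge0 ?divr_ge0// ltW.
have cb : 0 <= 1 + a / b by rewrite addr_ge0 ?divr_ge0// ltW.
apply: le_trans (lerD (ler_wpM2l ca F) (ler_wpM2l cb G)).
rewrite !mulr_sumr -big_split/=; apply: ler_sum => n _.
apply: (@le_trans _ _ ((normc (f n) + normc (g n)) ^+ 2)).
  by rewrite ler_sqr ?nnegrE ?addr_ge0 ?normc_ge0//; exact: le_normcD.
set x := normc _; set y := normc _.
rewrite -subr_ge0 (_ : _ - _ = (b * x - a * y) ^+ 2 / (a * b)).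
  by rewrite divr_ge0 ?sqr_ge0 ?mulr_ge0 ?ltW.
by field; rewrite f0 g0.
Qed.

Lemma ell2_ext f g : (forall n, f n = g n) -> f = g.
Proof. by move=> fg; apply: val_inj; apply/funext => n; exact: fg. Qed.

Lemma ell2E :
  (forall f g n, (f + g : ell2 R) n = f n + g n) *
  (forall f n, (- f : ell2 R) n = - f n) *
  (forall (a : R[i]) f n, (a *: f : ell2 R) n = a * f n).
Proof. by []. Qed.

Lemma ell2_sumE (I : Type) (s : seq I) (F : I -> ell2 R) n :
  (\sum_(i <- s) F i : ell2 R) n = \sum_(i <- s) F i n.
Proof. by elim: s => [|a s ih]; rewrite ?big_nil// !big_cons -ih. Qed.

(** A Fatou argument: every finite sum of squares passes to the limit and keeps the bound [c ^+ 2].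
    Applied to a sequence it produces the limit in [ell2]; applied to differences it gives the rate
    of convergence. *)
Lemma pointwise_limit h (g : nat -> ell2 R) (c : R) : 0 <= c ->
  (\forall j \near \oo, nrm (g j) <= c) ->
  (forall n, complex.Re (g j n) @[j --> \oo] --> complex.Re (h n)) ->
  (forall n, complex.Im (g j n) @[j --> \oo] --> complex.Im (h n)) ->
  exists2 f : ell2 R, ell2_fun f = h & nrm f <= c.
Proof.
move=> c0 gc gRe gIm.
have hc (s : seq int) : uniq s -> \sum_(n <- s) normc (h n) ^+ 2 <= c ^+ 2.
  move=> us.
  have lim : \sum_(n <- s) normc (g j n) ^+ 2 @[j --> \oo] -->
             \sum_(n <- s) normc (h n) ^+ 2.
    elim: s {us} => [|n s ih].
      by rewrite big_nil; under eq_fun do rewrite big_nil; exact: cvg_cst.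
    rewrite big_cons; under eq_fun do rewrite big_cons.
    apply: cvgD ih; rewrite normc_sqr; under eq_fun do rewrite normc_sqr.
    by apply: cvgD; rewrite expr2; under eq_fun do rewrite expr2; apply: cvgM.
  rewrite -(cvg_lim _ lim)//.
  apply: limr_le; first by apply/cvg_ex; eexists; exact: lim.
  near=> j; apply: le_trans (sum_le_nrm _ us) _.
  by rewrite ler_sqr ?nnegrE ?nrm_ge0//; near: j.
have h2 : h \in @square_summable R.
  by rewrite square_summableE (le_lt_trans (sqnorm_leP hc))// ltry.
by exists (Ell2 h2) => //; exact: nrm_leP.
Unshelve. all: by end_near. Qed.

End Norm.

(** * Bounded operators *)

Section BoundedOperators.
Variable R : realType.
Local Notation E := (ell2 R).
Implicit Types (f g : E) (A B T : E -> E) (c : R).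

Section LinearMaps.
Variables (A : E -> E) (lA : linear A).

Definition linear_pack : {linear E -> E} :=
  HB.pack A (GRing.isLinear.Build _ _ _ _ A lA).

Lemma linZ (a : R[i]) f : A (a *: f) = a *: A f.
Proof. exact: (linearZZ linear_pack). Qed.

Lemma linB f g : A (f - g) = A f - A g.
Proof. exact: (linearB linear_pack). Qed.

Lemma linD f g : A (f + g) = A f + A g.
Proof. exact: (linearD linear_pack). Qed.

Lemma lin0 : A 0 = 0.
Proof. exact: (linear0 linear_pack). Qed.

Lemma lin_sum (I : Type) (s : seq I) (F : I -> E) :
  A (\sum_(i <- s) F i) = \sum_(i <- s) A (F i).
Proof. exact: (linear_sum linear_pack). Qed.

End LinearMaps.

Lemma linear_id : linear (@id E).
Proof. by []. Qed.

Lemma linear_iter A k : linear A -> linear (iter k A).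
Proof. by move=> lA; elim: k => [//|k ih] a f g; rewrite !iterS ih lA. Qed.

Lemma linear_scale (a : R[i]) A : linear A -> linear (fun f => a *: A f).
Proof. by move=> lA b f g; rewrite lA scalerDr !scalerA mulrC. Qed.

Lemma linear_sub A B : linear A -> linear B -> linear (fun f => A f - B f).
Proof. by move=> lA lB b f g; rewrite lA lB scalerBr opprD addrACA. Qed.

Lemma linear_bigsum (I : Type) (s : seq I) (T : I -> E -> E) :
  (forall i, linear (T i)) -> linear (fun f => \sum_(i <- s) T i f).
Proof.
move=> lT a f g; rewrite scaler_sumr -big_split/=.
by apply: eq_bigr => i _; rewrite lT.
Qed.

Lemma linear_op_poly (p : {poly R[i]}) A : linear A -> linear (op_poly p A).
Proof.
by move=> lA; apply: linear_bigsum => i; apply: linear_scale; exact: linear_iter.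
Qed.

(** The working form of [opnorm A <= c] for linear [A], by [opnorm_le] and [opbd_opnorm]; it keeps
    all estimates in [R] instead of the extended reals. *)
Definition opbd A c := forall f, nrm (A f) <= c * nrm f.

Lemma opbd_comp A B a b : 0 <= a -> opbd A a -> opbd B b -> opbd (A \o B) (a * b).
Proof.
by move=> a0 hA hB f; rewrite (le_trans (hA _))// -mulrA ler_wpM2l.
Qed.

Lemma opbd_iter A a k : 0 <= a -> opbd A a -> opbd (iter k A) (a ^+ k).
Proof.
move=> a0 hA; elim: k => [|k ih] f; first by rewrite expr0 mul1r.
by rewrite iterS exprS; apply: (opbd_comp (B := iter k A)).
Qed.

Lemma opbd_scale (z : R[i]) A a : opbd A a -> opbd (fun f => z *: A f) (normc z * a).
Proof. by move=> hA f; rewrite nrmZ -mulrA ler_wpM2l ?normc_ge0. Qed.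

Lemma opnorm_ge0 A : (0 <= opnorm A)%E.
Proof.
apply: (@le_trans _ _ (enorm (A 0))).
  by rewrite enormE lee_fin nrm_ge0.
apply: ereal_sup_ubound; exists 0 => //.
by rewrite /mkset enormE nrm0 lee_fin.
Qed.

Lemma opnorm_le A c : 0 <= c -> opbd A c -> (opnorm A <= c%:E)%E.
Proof.
move=> c0 hA; apply: ge_ereal_sup => _ [f + <-]; rewrite /mkset !enormE !lee_fin => f1.
by rewrite (le_trans (hA _))// -[leRHS]mulr1 ler_wpM2l.
Qed.

Lemma opbd_opnorm A c : linear A -> (opnorm A <= c%:E)%E -> opbd A c.
Proof.
move=> lA hA f; have [f0|f0] := eqVneq (nrm f) 0.
  by rewrite (nrm_eq0 f0) (lin0 lA) nrm0 mulr0.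
have fp : 0 < nrm f by rewrite lt_neqAle eq_sym f0 nrm_ge0.
have h (x : R) : 0 < x -> normc x%:C^-1 = x^-1.
  by move=> x0; rewrite normcV normc_real gtr0_norm.
have : (enorm (A ((nrm f)%:C^-1 *: f)) <= opnorm A)%E.
  apply: ereal_sup_ubound; exists ((nrm f)%:C^-1 *: f) => //.
  by rewrite /mkset enormE nrmZ h// mulVf.
move=> /le_trans/(_ hA).
by rewrite (linZ lA) enormE nrmZ h// lee_fin ler_pdivrMl// mulrC.
Qed.

Lemma bounded_operatorI A c : linear A -> 0 <= c -> opbd A c -> bounded_operator A.
Proof.
by move=> lA c0 hA; split=> //; rewrite (le_lt_trans (opnorm_le c0 hA))// ltry.
Qed.

Lemma bounded_operatorE A : bounded_operator A ->
  linear A /\ exists2 c, 0 <= c & opbd A c.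
Proof.
move=> [lA hA]; split=> //.
exists (fine (opnorm A)); first by rewrite fine_ge0 ?opnorm_ge0.
by apply: opbd_opnorm => //; rewrite fineK// ge0_fin_numE ?opnorm_ge0.
Qed.

Definition opcv (T : nat -> E -> E) B := forall e, 0 < e ->
  \forall n \near \oo, opbd (fun f => T n f - B f) e.

Lemma op_cvgP (T : nat -> E -> E) B : (forall n, linear (T n)) -> linear B ->
  op_cvg T B <-> opcv T B.
Proof.
move=> lT lB; have lTB n := linear_sub (lT n) lB; split.
  move=> /fine_cvgP[fT /cvgrPdist_lt cT] e e0; have {}cT := cT _ e0.
  near=> n; apply: opbd_opnorm; first exact: lTB.
  have fn : opnorm (fun f => T n f - B f) \is a fin_num by near: n.
  rewrite -(fineK fn) lee_fin ltW// (le_lt_trans (ler_norm _))//.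
  rewrite -normrN -[- _]add0r.
  by near: n; exact: cT.
move=> cT; apply/fine_cvgP; split.
  have {}cT := cT _ ltr01; near=> n.
  rewrite ge0_fin_numE ?opnorm_ge0// (@le_lt_trans _ _ 1%:E) ?ltry//.
  by apply: opnorm_le => //; near: n; exact: cT.
apply/cvgrPdist_le => e e0; have {}cT := cT _ e0; near=> n.
rewrite sub0r normrN ger0_norm ?fine_ge0 ?opnorm_ge0//.
have le : (opnorm (fun f => (T n f - B f)%R) <= e%:E)%E.
  by apply: opnorm_le; [exact: ltW|near: n; exact: cT].
rewrite -lee_fin fineK// ge0_fin_numE ?opnorm_ge0//.
by rewrite (le_lt_trans le)// ltry.
Unshelve. all: by end_near. Qed.

Lemma opcv_cvg (T : nat -> E -> E) B f : opcv T B ->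
  forall e, 0 < e -> \forall n \near \oo, nrm (T n f - B f) <= e.
Proof.
move=> cT e e0; have h : 0 < e / (nrm f + 1).
  by rewrite divr_gt0// ltr_wpDl// nrm_ge0.
have := cT _ h; apply: filterS => n /(_ f) /le_trans; apply.
rewrite mulrAC ler_pdivrMr ?ler_pM2l ?lerDl// ltr_wpDl// nrm_ge0//.
Qed.

Lemma nrm_small_eq0 f : (forall e, 0 < e -> nrm f <= e) -> f = 0.
Proof.
move=> h; apply: nrm_eq0; apply/le_anti; rewrite nrm_ge0 andbT.
by apply/ler_addgt0Pl => e e0; rewrite addr0 h.
Qed.

Lemma Re_sub (z w : R[i]) : complex.Re (z - w) = complex.Re z - complex.Re w.
Proof. by case: z => a b; case: w. Qed.

Lemma Re_le_normc (z : R[i]) : `|complex.Re z| <= normc z.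
Proof.
by rewrite -ler_sqr ?nnegrE ?normc_ge0// normc_sqr -normrX ger0_norm ?sqr_ge0// lerDl sqr_ge0.
Qed.

Lemma Im_sub (z w : R[i]) : complex.Im (z - w) = complex.Im z - complex.Im w.
Proof. by case: z => a b; case: w. Qed.

Lemma Im_le_normc (z : R[i]) : `|complex.Im z| <= normc z.
Proof.
by rewrite -ler_sqr ?nnegrE ?normc_ge0// normc_sqr -normrX ger0_norm ?sqr_ge0// lerDr sqr_ge0.
Qed.

(* Absolute summability is phrased with a sequence [tau] of tails, so that the
   bounds telescope. *)
Section AbsolutelyConvergentSeries.
Variables (T : nat -> E -> E) (tau : nat -> R).
Hypothesis lT : forall k, linear (T k).
Hypothesis bT : forall k, opbd (T k) (tau k - tau k.+1).
Hypothesis tau_ge0 : forall k, 0 <= tau k.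
Hypothesis tau_cvg : tau @ \oo --> 0.

Let S n f := \sum_(k < n) T k f.

Let S_cauchy f m n : (m <= n)%N -> nrm (S n f - S m f) <= tau m * nrm f.
Proof.
move=> mn; rewrite -(subnKC mn); move: (n - m)%N => j.
apply: (@le_trans _ _ ((tau m - tau (m + j)%N) * nrm f)); last first.
  by rewrite ler_wpM2r ?nrm_ge0// gerBl.
elim: j => [|j ih]; first by rewrite addn0 !subrr nrm0 mul0r.
rewrite addnS /S big_ord_recr/= -/(S (m + j) f) addrAC.
apply: le_trans (nrmD _ _) _.
have := bT (m + j)%N f; move: ih => /lerD /[apply] /le_trans; apply.
by rewrite -mulrDl; apply: ler_wpM2r; rewrite ?nrm_ge0//; lra.
Qed.

(** [part] stands for the real or the imaginary part, so that the completeness used is that of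
    [R]. *)
Let S_part (part : R[i] -> R) f n :
  (forall z w, part (z - w) = part z - part w) ->
  (forall z, `|part z| <= normc z) ->
  exists l : R, part (S j f n) @[j --> \oo] --> l.
Proof.
move=> partB part_le; suff /cvg_ex[l hl] : cvgn (fun j => part (S j f n)) by exists l.
apply/cauchy_cvgP/cauchy_exP => _/posnumP[e].
have ht : 0 < e%:num / (nrm f + 1) by rewrite divr_gt0// ltr_wpDl// nrm_ge0.
have /cvgrPdist_lt/(_ _ ht)[N _ hN] := tau_cvg.
exists (part (S N f n)); exists N => // j /= Nj.
rewrite /ball/= -partB (le_lt_trans (part_le _))// normcB.
rewrite (le_lt_trans (normc_le_nrm (S j f - S N f) n))//.
rewrite (le_lt_trans (S_cauchy _ _))//.
have := hN N (leqnn _); rewrite sub0r normrN ger0_norm// ltr_pdivlMr; last first.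
  by rewrite ltr_wpDl// nrm_ge0.
by apply: le_lt_trans; rewrite ler_wpM2l// lerDl.
Qed.

Lemma abs_cvg_series : exists B, [/\ linear B, exists2 c, 0 <= c & opbd B c &
  opcv (fun n f => \sum_(k < n) T k f) B].
Proof.
have exB f : exists g, forall m, nrm (g - S m f) <= tau m * nrm f.
  have [r hr] := choice (fun n => @S_part (@complex.Re R) f n Re_sub Re_le_normc).
  have [s hs] := choice (fun n => @S_part (@complex.Im R) f n Im_sub Im_le_normc).
  have [|||| g gE _] := @pointwise_limit R (fun n => r n +i* s n)
    (fun j => S j f) (tau 0%N * nrm f).
  - by rewrite mulr_ge0 ?nrm_ge0.
  - by near=> j; have := @S_cauchy f 0 j (leq0n _); rewrite {2}/S big_ord0 subr0.
  - exact: hr.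
  - exact: hs.
  exists g => m.
  (* The same limit taken along [S j f - S m f] bounds the distance from [g] to [S m f]. The rate is
     [tau m] times [nrm f], hence convergence in operator norm. *)
  have [|||| g' g'E le] := @pointwise_limit R (g - S m f) (fun j => S j f - S m f) (tau m * nrm f).
  - by rewrite mulr_ge0 ?nrm_ge0.
  - by exists m => // j /=; exact: S_cauchy.
  - move=> n; under eq_fun do rewrite [complex.Re _]Re_sub.
    rewrite [complex.Re _]Re_sub.
    by apply: cvgB; [rewrite [\val g]gE; exact: hr|exact: cvg_cst].
  - move=> n; under eq_fun do rewrite [complex.Im _]Im_sub.
    rewrite [complex.Im _]Im_sub.
    by apply: cvgB; [rewrite [\val g]gE; exact: hs|exact: cvg_cst].
  by rewrite (_ : g - _ = g')//; exact: val_inj.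
have [B hB] := choice exB.
have SB : opcv S B.
  move=> e e0; have /cvgrPdist_le/(_ _ e0) := tau_cvg.
  apply: filterS => n; rewrite sub0r normrN ger0_norm// => le f.
  by rewrite nrmB (le_trans (hB _ _))// ler_wpM2r ?nrm_ge0.
have lS n : linear (S n) by exact: linear_bigsum.
exists B; split=> //.
  move=> a f g; apply/eqP; rewrite -subr_eq0; apply/eqP/nrm_small_eq0 => e e0.
  (* Three approximation errors occur, with weights [1], [normc a] and [1]. *)
  have e30 : 0 < e / (normc a + 2).
    by rewrite divr_gt0// ltr_wpDl// normc_ge0.
  have h1 := opcv_cvg (a *: f + g) SB e30.
  have h2 := opcv_cvg f SB e30.
  have h3 := opcv_cvg g SB e30.
  near \oo => n.
  rewrite (_ : _ - _ = - (S n (a *: f + g) - B (a *: f + g)) +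
     (a *: (S n f - B f) + (S n g - B g))); last first.
    by rewrite lS; apply: ell2_ext => m; rewrite !ell2E; ring.
  have k1 : nrm (S n (a *: f + g) - B (a *: f + g)) <= e / (normc a + 2) by near: n.
  have k2 : nrm (S n f - B f) <= e / (normc a + 2) by near: n.
  have k3 : nrm (S n g - B g) <= e / (normc a + 2) by near: n.
  apply: le_trans (nrmD _ _) _; rewrite nrmN.
  apply: le_trans (lerD k1 (nrmD _ _)) _; rewrite nrmZ.
  apply: le_trans (lerD (lexx _) (lerD (ler_wpM2l (normc_ge0 a) k2) k3)) _.
  have a0 : 0 < normc a + 2 by rewrite ltr_wpDl// normc_ge0.
  by rewrite le_eqVlt; apply/orP; left; apply/eqP; field; rewrite gt_eqF.
exists (tau 0%N) => // f.
by have := hB f 0%N; rewrite {1}/S big_ord0 subr0.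
Unshelve. all: by end_near. Qed.
End AbsolutelyConvergentSeries.

End BoundedOperators.

(** * The discrete Laplacian and its spectrum *)

Section Laplacian.
Variable R : realType.
Local Notation E := (ell2 R).
Local Notation A := (@neg_laplacian R).
Implicit Types (f g : E).

Definition translate (k : int) f : E := Ell2 (square_summable_shift k (ell2P f)).

Lemma nrm_translate k f : nrm (translate k f) = nrm f.
Proof. by rewrite /nrm/= sqnorm_shift. Qed.

Lemma neg_laplacianE f n : A f n = 2 * f n - f (n - 1) - f (n + 1).
Proof. by []. Qed.

Lemma linear_neg_laplacian : linear A.
Proof.
by move=> a f g; apply: ell2_ext => n; rewrite !(ell2E, neg_laplacianE); ring.
Qed.

(** By [averagingE] this is the mean of the two unit shifts, hence a contraction; both ends of the
    spectral bound [[0, 4]] come from that. *)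
Definition averaging f : E := f - 2^-1 *: A f.

Lemma averagingE f : averaging f = 2^-1 *: (translate 1 f + translate (- 1) f).
Proof.
apply: ell2_ext => n; rewrite !(ell2E, neg_laplacianE)/=.
by field.
Qed.

Lemma linear_averaging : linear averaging.
Proof.
by apply: linear_sub; [exact: linear_id|apply/linear_scale/linear_neg_laplacian].
Qed.

Lemma normc_nat_inv n : normc (n%:R^-1 : R[i]) = n%:R^-1.
Proof. by rewrite normcV -(rmorph_nat (real_complex R)) normc_real normr_nat. Qed.

Lemma opbd_averaging : opbd averaging 1.
Proof.
move=> f; rewrite averagingE nrmZ normc_nat_inv mul1r.
rewrite ler_pdivrMl// (le_trans (nrmD _ _))// !nrm_translate.
by rewrite mulr_natl mulr2n.
Qed.

Lemma opbd_neg_laplacian : opbd A 4.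
Proof.
have AE f : A f = 2 *: (f - averaging f).
  rewrite /averaging opprB addrCA subrr addr0 scalerA divff ?scale1r//.
move=> f; rewrite AE nrmZ -(rmorph_nat (real_complex R)) normc_real normr_nat.
rewrite (_ : 4 = 2 * (1 + 1) :> R); last by ring.
rewrite -mulrA ler_wpM2l//.
rewrite mulrDl (le_trans (nrmD _ _))// nrmN lerD//; last exact: opbd_averaging.
by rewrite mul1r.
Qed.

(** The inverse of [1 - V] is the series of the iterates of [V], with tails [r ^+ k / (1 - r)]. Its
    partial sums telescope on [f - V f] to [f - iter n V f], and both identities, which [spectrum]
    asks for, are limits of this. *)
Lemma neumann_series V (r : R) : linear V -> 0 <= r < 1 -> opbd V r ->
  exists G, [/\ bounded_operator G, forall f, G (f - V f) = f &
                forall f, G f - V (G f) = f].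
Proof.
move=> lV /andP[r0 r1] bV.
have r1' : 0 < 1 - r by rewrite subr_gt0.
have r1n := gt_eqF r1'.
have rcvg : (fun k => r ^+ k / (1 - r)) @ \oo --> (0 : R).
  rewrite (_ : (fun k => _) = geometric (1 - r)^-1 r).
    by apply: cvg_geometric; rewrite ger0_norm.
  by apply/funext => k; rewrite /= mulrC.
have [||||G [lG [c c0 bG] cG]] := @abs_cvg_series R (fun k => iter k V)
  (fun k => r ^+ k / (1 - r)).
- by move=> k; exact: linear_iter.
- move=> k; have -> : r ^+ k / (1 - r) - r ^+ k.+1 / (1 - r) = r ^+ k.
    by rewrite exprS; field; rewrite r1n.
  exact: opbd_iter.
- by move=> k; rewrite divr_ge0 ?exprn_ge0 ?(ltW r1').
- exact: rcvg.
have rf f e : 0 < e -> \forall k \near \oo, nrm (iter k V f) <= e.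
  move=> e0; have h : 0 < e / (nrm f + 1) / (1 - r).
    by rewrite !divr_gt0// ltr_wpDl ?nrm_ge0.
  have /cvgrPdist_le/(_ _ h) := rcvg.
  apply: filterS => k; rewrite sub0r normrN ger0_norm; last first.
    by rewrite divr_ge0 ?exprn_ge0 ?(ltW r1').
  rewrite ler_pdivrMr// mulfVK ?r1n// => hk.
  apply: le_trans (opbd_iter k r0 bV f) _.
  have f1 : 0 < nrm f + 1 by rewrite ltr_wpDl ?nrm_ge0.
  apply: le_trans (ler_wpM2r (nrm_ge0 f) hk) _.
  rewrite mulrAC ler_pdivrMr// ler_pM2l// lerDl//.
have geo n f : \sum_(k < n) iter k V (f - V f) = f - iter n V f.
  elim: n => [|n ih]; first by rewrite big_ord0 subrr.
  rewrite big_ord_recr/= ih (linB (linear_iter n lV)) -iterSr iterS.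
  by rewrite addrA addrNK.
exists G; split; first exact: bounded_operatorI bG.
- move=> f; apply/eqP; rewrite -subr_eq0; apply/eqP/nrm_small_eq0 => e e0.
  have e20 : 0 < e / 2 by rewrite divr_gt0.
  have h1 := opcv_cvg (f - V f) cG e20; have h2 := rf f _ e20.
  near \oo => n.
  have k1 : nrm (\sum_(k < n) iter k V (f - V f) - G (f - V f)) <= e / 2 by near: n.
  have k2 : nrm (iter n V f) <= e / 2 by near: n.
  rewrite geo in k1.
  rewrite (_ : _ - f = - ((f - iter n V f - G (f - V f)) + iter n V f)).
    by rewrite nrmN (le_trans (nrmD _ _))// (splitr e) lerD.
  by rewrite addrAC addrNK opprB.
- move=> f; apply/eqP; rewrite -subr_eq0; apply/eqP/nrm_small_eq0 => e e0.
  have e20 : 0 < e / 3 by rewrite divr_gt0.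
  have h1 := opcv_cvg f cG e20; have h2 := rf f _ e20.
  near \oo => n.
  have k1 : nrm (\sum_(k < n) iter k V f - G f) <= e / 3 by near: n.
  have k2 : nrm (iter n V f) <= e / 3 by near: n.
  have := geo n f.
  under eq_bigr do rewrite (linB (linear_iter _ lV)) -iterSr iterS.
  rewrite sumrB -(lin_sum lV); set s := \sum_(k < n) _ => gs.
  (* Replacing [G f] by the partial sum [s] costs [s - G f] twice, once through the contraction [V],
     and [s - V s] misses [f] by [iter n V f]: three errors of size [e / 3]. *)
  rewrite (_ : _ - f = - (s - G f) + V (s - G f) - iter n V f); last first.
    rewrite (linB lV) opprB (_ : iter n V f = f - (s - V s)); last first.
      by rewrite gs subKr.
    by apply: ell2_ext => m; rewrite !ell2E; ring.
  have := bV (s - G f); rewrite -/s in k1 => bs.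
  apply: le_trans (nrmD _ _) _; rewrite nrmN.
  apply: le_trans (lerD (nrmD _ _) k2) _; rewrite nrmN.
  have : nrm (V (s - G f)) <= e / 3.
    by rewrite (le_trans bs)// (le_trans _ k1)// ler_piMl ?nrm_ge0 ?ltW.
  lra.
Unshelve. all: by end_near. Qed.

(** For [x] outside the interval, [c = 1 - x / 2] has modulus above [1], and
    [A - x = 2 c (1 - averaging / c)] is inverted by a Neumann series. *)
Lemma spectrum_neg_laplacian (x : R) : spectrum A x%:C -> 0 <= x <= 4.
Proof.
apply: contraPT; rewrite /spectrum /mkset => x04.
apply; pose c := 1 - x / 2.
have c1 : 1 < `|c|.
  move: x04; rewrite negb_and -!ltNge ltr_normr => /orP[x0|x4].
    by apply/orP; left; rewrite /c; lra.
  by apply/orP; right; rewrite /c; lra.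
have c0 : c != 0 by rewrite -normr_gt0 (lt_trans ltr01).
have cC0 : c%:C != 0 by rewrite fmorph_eq0.
have c1' : 0 <= `|c|^-1 < 1 by rewrite invr_ge0 normr_ge0 invf_lt1// (lt_trans ltr01).
have lV : linear (fun f => c%:C^-1 *: averaging f).
  by apply: linear_scale; exact: linear_averaging.
have bV : opbd (fun f => c%:C^-1 *: averaging f) `|c|^-1.
  have := opbd_scale (c%:C^-1) opbd_averaging.
  by rewrite normcV normc_real mulr1.
have [G [bG GV VG]] := neumann_series lV c1' bV.
have AE f : A f - x%:C *: f = (2 * c%:C) *: (f - c%:C^-1 *: averaging f).
  have xE : x%:C = 2 - 2 * c%:C.
    by rewrite /c !(rmorphB, rmorphM, rmorph1) fmorphV rmorph_nat; field.
  by apply: ell2_ext => n; rewrite /averaging xE !ell2E; field.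
have d0 : 2 * c%:C != 0 :> R[i] by rewrite mulf_neq0// pnatr_eq0.
have [lG bdG'] := bounded_operatorE bG; case: bdG' => b b0 bdG.
exists (fun g => G ((2 * c%:C)^-1 *: g)); split.
- apply: (@bounded_operatorI _ _ (b * normc (2 * c%:C)^-1)).
  + by move=> a f g; rewrite scalerDr -lG; congr (G (_ + _)); rewrite !scalerA mulrC.
  + by rewrite mulr_ge0 ?normc_ge0.
  + by move=> f; rewrite (le_trans (bdG _))// nrmZ mulrA.
- by move=> f; rewrite AE scalerA mulVf// scale1r GV.
- by move=> f; rewrite AE VG scalerA mulfV// scale1r.
Qed.

(** * Polynomials in an operator *)

Section OpPoly.
Variables (A : E -> E) (lA : linear A).
Implicit Types p q : {poly R[i]}.

Lemma op_poly_widen p n f : (size p <= n)%N ->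
  op_poly p A f = \sum_(k < n) p`_k *: iter k A f.
Proof.
move=> pn; rewrite /op_poly (big_ord_widen _ (fun k => p`_k *: iter k A f) pn).
rewrite big_mkcond/=; apply: eq_bigr => k _; case: ltnP => // /(nth_default 0) ->.
by rewrite scale0r.
Qed.

Lemma op_polyD p q f : op_poly (p + q) A f = op_poly p A f + op_poly q A f.
Proof.
pose n := maxn (size p) (size q).
rewrite !(@op_poly_widen _ n) ?leq_maxl ?leq_maxr ?size_polyD// -big_split/=.
by apply: eq_bigr => k _; rewrite coefD scalerDl.
Qed.

Lemma op_polyZ (a : R[i]) p f : op_poly (a *: p) A f = a *: op_poly p A f.
Proof.
rewrite !(@op_poly_widen _ (size p)) ?size_scale_leq// scaler_sumr.
by apply: eq_bigr => k _; rewrite coefZ scalerA.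
Qed.

Lemma op_polyXM p f : op_poly ('X * p) A f = A (op_poly p A f).
Proof.
rewrite (@op_poly_widen _ (size p).+1); last first.
  by rewrite (leq_trans (size_polyMleq _ _))// size_polyX.
rewrite big_ord_recl coefXM scale0r add0r (lin_sum lA).
by apply: eq_bigr => k _; rewrite coefXM/= (linZ lA).
Qed.

Lemma op_poly1 f : op_poly 1 A f = f.
Proof. by rewrite /op_poly size_poly1 big_ord1 coef1 scale1r. Qed.

Lemma op_poly0 f : op_poly 0 A f = 0.
Proof. by rewrite /op_poly size_poly0 big_ord0. Qed.

Lemma op_poly_sum (I : Type) (s : seq I) (P : I -> {poly R[i]}) f :
  op_poly (\sum_(i <- s) P i) A f = \sum_(i <- s) op_poly (P i) A f.
Proof.
elim: s => [|i s ih]; first by rewrite !big_nil op_poly0.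
by rewrite !big_cons op_polyD ih.
Qed.

Lemma op_poly_affineX (a : R[i]) k f :
  op_poly ((1 - a *: 'X) ^+ k) A f = iter k (fun g => g - a *: A g) f.
Proof.
elim: k => [|k ih]; first by rewrite expr0 op_poly1.
set q := (_ ^+ k) in ih *.
rewrite (_ : _ ^+ k.+1 = q + (- a) *: ('X * q)); last first.
  by rewrite exprS mulrBl mul1r -scalerAl scaleNr.
by rewrite op_polyD op_polyZ op_polyXM ih scaleNr.
Qed.

End OpPoly.

End Laplacian.

(** * The binomial series *)

Section BinomialSeries.
Variables (R : realType) (alpha : R).
Hypothesis alpha01 : 0 < alpha < 1.

(* The partial sums at [c = 1] of the binomial series of [(1 - c)^alpha]. *)
Fixpoint binq n : R := if n is m.+1 then binq m * (1 - alpha / m.+1%:R) else 1.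

(** The coefficient of [c^k] in [(1 - c)^alpha], written as an increment of the partial sums at
    [c = 1]. It is nonpositive from [k = 1] on, so sums of absolute values telescope in [binq]. *)
Definition bincoef k : R := if k is m.+1 then binq m.+1 - binq m else 1.

Definition binsum n (c : R) : R := \sum_(k < n) bincoef k * c ^+ k.

Lemma binq_ge0 n : 0 <= binq n.
Proof.
elim: n => [|n ih] /=; first exact: ler01.
rewrite mulr_ge0// subr_ge0 ler_pdivrMr// mul1r.
by rewrite (@le_trans _ _ 1)// ?ler1n// ltW//; case/andP: alpha01.
Qed.

Lemma binq_leS n : binq n.+1 <= binq n.
Proof.
rewrite /= -[leRHS]mulr1 ler_wpM2l ?binq_ge0// gerBl divr_ge0// ltW//.
by case/andP: alpha01.
Qed.

Lemma binq_le1 n : binq n <= 1.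
Proof. by elim: n => // n /(le_trans (binq_leS n)). Qed.

Lemma binsumS n c : binsum n.+2 c = binsum n.+1 c + (binq n.+1 - binq n) * c ^+ n.+1.
Proof. by rewrite /binsum big_ord_recr. Qed.

Lemma binsum_at0 n : binsum n.+1 0 = 1.
Proof.
rewrite /binsum big_ord_recl/= expr0 mulr1 big1 ?addr0// => k _.
by rewrite expr0n mulr0.
Qed.

Lemma binsum_at1 n : binsum n.+1 1 = binq n.
Proof.
elim: n => [|n ih]; first by rewrite /binsum big_ord1 expr0 mulr1.
by rewrite binsumS ih expr1n mulr1 addrC subrK.
Qed.

(** The full series solves [(1 - x) y' + alpha y = 0]; truncation leaves only the term of top degree
    on the right. *)
Lemma is_derive_binsum n (x : R) : exists2 d : R, is_derive x 1 (binsum n.+1) d &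
  (1 - x) * d + alpha * binsum n.+1 x = alpha * binq n * x ^+ n.
Proof.
elim: n => [|n [d hd eqd]].
  exists 0.
    rewrite (_ : binsum 1 = cst 1); last first.
      by apply/funext => y; rewrite /binsum big_ord1 expr0 mulr1.
    exact: is_derive_cst.
  by rewrite mulr0 add0r /binsum big_ord1 expr0 !mulr1.
have dX : is_derive x 1 (fun y : R => y ^+ n.+1) (n.+1%:R * x ^+ n).
  have := is_deriveX n.+1 (is_derive_id x (1 : R)).
  by rewrite [_ *: _]mulr1 fctE.
exists (d + (binq n.+1 - binq n) * (n.+1%:R * x ^+ n)).
  rewrite (_ : binsum n.+2 = binsum n.+1 + (binq n.+1 - binq n) *: (fun y : R => y ^+ n.+1)).
    exact: is_deriveD.
  by apply/funext => y; rewrite binsumS.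
rewrite binsumS !mulrDr addrACA eqd exprS.
have -> : binq n.+1 - binq n = - (alpha * binq n / n.+1%:R) by rewrite /=; ring.
rewrite /=; field; by rewrite nat1r pnatr_eq0.
Qed.

(** The quotient [h] of the partial sum by [(1 - c)^alpha] equals [1] at [0], and by the truncated
    equation its derivative [dh] is nonnegative. The mean value theorem then bounds [h c - 1] from
    both sides. *)
Lemma binsum_bounds n (c : R) : 0 < c < 1 ->
  (1 - c) `^ alpha <= binsum n.+1 c <= (1 - c) `^ alpha + c ^+ n / (1 - c).
Proof.
move=> /andP[c0 c1]; have [a0 a1] := andP alpha01.
pose h := (binsum n.+1 : R -> R) * (fun x : R => (1 - x) `^ (- alpha)).
pose dh (x : R) : R := alpha * binq n * x ^+ n * (1 - x) `^ (- alpha - 1).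
have hD (x : R) : x < 1 -> is_derive x 1 h (dh x).
  move=> x1; have x1' : 0 < 1 - x by rewrite subr_gt0.
  have [d hd eqd] := is_derive_binsum n x.
  have D1 : is_derive x 1 (fun y : R => 1 - y) (-1).
    by have := is_deriveB (is_derive_cst (1 : R) x (1 : R)) (is_derive_id x (1 : R)); rewrite sub0r.
  have D2 : is_derive x 1 (fun x : R => (1 - x) `^ (- alpha))
      (- alpha * (1 - x) `^ (- alpha - 1) * -1).
    exact: (@is_derive1_comp _ (fun y : R => y `^ (- alpha)) (fun y : R => 1 - y) x
      _ _ (is_derive1_powR _ x1') D1).
  have D3 := is_deriveM hd D2.
  suff -> : dh x = binsum n.+1 x * (- alpha * (1 - x) `^ (- alpha - 1) * -1) +
      (1 - x) `^ (- alpha) * d by exact: D3.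
  rewrite /dh -eqd.
  have -> : (1 - x) `^ (- alpha) = (1 - x) * (1 - x) `^ (- alpha - 1).
    have := @powRD _ (1 - x) 1 (- alpha - 1); rewrite (gt_eqF x1') implybT powRr1 ?ltW//.
    by move=> <-//; congr (_ `^ _); ring.
  by move: (binsum _ _) (powR _ _) => u v; ring.
have [xi xic hE] : exists2 xi, xi \in `]0, c[%R & h c - h 0 = dh xi * (c - 0).
  apply: MVT => //.
    move=> x; rewrite in_itv/= => /andP[_ xc]; apply: hD; exact: lt_trans c1.
  apply: derivable_within_continuous => x; rewrite in_itv/= => /andP[_ xc].
  exact: (@ex_derive _ _ _ _ _ _ _ (hD x (le_lt_trans xc c1))).
move: xic; rewrite in_itv/= => /andP[xi0 xic].
have hval x : h x = binsum n.+1 x * (1 - x) `^ (- alpha) by [].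
have h0 : h 0 = 1 by rewrite hval binsum_at0 subr0 powR1 mulr1.
have pc : 0 < (1 - c) `^ (- alpha) by rewrite powR_gt0// subr_gt0.
have dh0 : 0 <= dh xi.
  by rewrite /dh !mulr_ge0 ?powR_ge0 ?exprn_ge0 ?binq_ge0 ?ltW.
have hlow : 0 <= h c - h 0 by rewrite hE mulr_ge0// subr0 ltW.
(* The factors [c], [alpha] and [binq n] are at most [1], and the two remaining factors of [dh]
   increase from [xi] to [c]. *)
have hup : h c - h 0 <= c ^+ n * (1 - c) `^ (- alpha - 1).
  rewrite hE subr0; apply: (@le_trans _ _ (dh xi * 1)).
    by rewrite ler_wpM2l// ltW.
  rewrite mulr1 /dh; apply: ler_pM.
  - by rewrite !mulr_ge0 ?exprn_ge0 ?binq_ge0 ?ltW.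
  - exact: powR_ge0.
  - apply: (@le_trans _ _ (1 * xi ^+ n)).
      apply: ler_wpM2r; first by rewrite exprn_ge0 ?ltW.
      by rewrite -[leRHS]mulr1 ler_pM ?binq_ge0 ?binq_le1 ?ltW.
    by rewrite mul1r lerXn2r ?nnegrE ?ltW.
  - rewrite -opprD !powRN lef_pV2 ?posrE ?powR_gt0 ?subr_gt0//; last exact: lt_trans c1.
    apply: ge0_ler_powR; rewrite ?nnegrE ?subr_ge0 ?lerD2l ?lerN2 ?addr_ge0 ?ltW//.
    exact: lt_trans c1.
rewrite h0 hval in hlow hup.
have n1 : 1 - c != 0 by rewrite gt_eqF ?subr_gt0.
have pE : (1 - c) `^ (- alpha) * (1 - c) `^ alpha = 1.
  by rewrite -powRD ?n1 ?implybT// addNr powRr0.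
have pE1 : (1 - c) `^ (- alpha - 1) * (1 - c) `^ alpha = (1 - c)^-1.
  rewrite -powRD ?n1 ?implybT//.
  by rewrite addrAC addNr add0r powR_inv1 ?subr_ge0 ?ltW.
have pa := powR_ge0 (1 - c) alpha.
apply/andP; split.
  rewrite -subr_ge0; apply: le_trans (mulr_ge0 hlow pa) _.
  by rewrite mulrBl -mulrA pE mulr1 mul1r.
have := ler_wpM2r pa hup.
by rewrite mulrBl -!mulrA pE pE1 mulr1 mul1r lerBlDl.
Qed.

(** All coefficients past the first are nonpositive, so the partial sum is smallest at [c = 1],
    where it equals [binq n]. *)
Lemma binq_le_binsum n c : 0 <= c <= 1 -> binq n <= binsum n.+1 c.
Proof.
move=> /andP[c0 c1]; rewrite -binsum_at1; elim: n => [|n ih].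
  by rewrite /binsum !big_ord1 !expr0.
rewrite !binsumS lerD// ler_wnM2l ?subr_le0 ?binq_leS// expr1n.
exact: exprn_ile1.
Qed.

Lemma binsum_diff n j c : 0 <= c <= 1 ->
  binsum n.+1 c <= binsum (n + j).+1 c + (binq n - binq (n + j)).
Proof.
move=> /andP[c0 c1]; elim: j => [|j ih]; first by rewrite addn0 subrr addr0.
apply: le_trans ih _; rewrite addnS binsumS.
have := binq_leS (n + j); set u := binq _; set v := binq _ => uv.
have : (v - u) * c ^+ (n + j).+1 <= v - u.
  by rewrite -[leRHS]mulr1 ler_wpM2l ?subr_ge0// exprn_ile1.
lra.
Qed.

(** At [c = 1 - x] the previous bounds give [binq n <= x^alpha + (1 - x)^n / x]. First [x] is fixed
    so that the first term is small, then [n] makes the second one small. *)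
Lemma binq_cvg0 : binq @ \oo --> 0.
Proof.
have [a0 a1] := andP alpha01.
apply/cvgrPdist_le => e e0.
have e20 : 0 < e / 2 by rewrite divr_gt0.
have /cvgrPdist_lt/(_ _ e20) pow_small := powR_cvg0 a0.
near (0 : R)^'+ => x.
have x0 : 0 < x by near: x; exact: nbhs_right_gt.
have x1 : x < 1 by near: x; exact: nbhs_right_lt.
have xa : x `^ alpha < e / 2.
  by rewrite -[ltLHS]ger0_norm ?powR_ge0// -normrN -[- _]add0r; near: x.
have c01 : 0 < 1 - x < 1 by rewrite subr_gt0 x1 gtrBl x0.
have [c0 c1] := andP c01.
have ex0 : 0 < e / 2 * x by rewrite mulr_gt0.
have /cvgrPdist_le/(_ _ ex0) geo : geometric 1 (1 - x) @ \oo --> (0 : R).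
  by apply: cvg_geometric; rewrite ger0_norm ?ltW.
near=> n.
have cn : (1 - x) ^+ n <= e / 2 * x.
  rewrite -[leLHS]ger0_norm ?exprn_ge0 ?(ltW c0)// -normrN -[- _]add0r -[_ ^+ _]mul1r.
  by near: n.
rewrite sub0r normrN ger0_norm ?binq_ge0//.
have c01w : 0 <= 1 - x <= 1 by rewrite (ltW c0) (ltW c1).
apply: le_trans (binq_le_binsum n c01w) _.
have /andP[_] := binsum_bounds n c01; move=> /le_trans; apply.
rewrite subKr (splitr e) lerD//; first exact: ltW.
by rewrite ler_pdivrMr.
Unshelve. all: by end_near. Qed.

(** The terms from [n + 1] to [n + j] amount to at most [binq n - binq (n + j)], and the partial sum
    of index [n + j] is within [c^(n + j) / (1 - c)] of the limit; [j] tends to infinity. The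
    endpoint [c = 1], the bottom of the spectrum, is checked by hand because that second bound
    degenerates there. *)
Lemma binsum_unif n c : 0 <= c <= 1 ->
  `|binsum n.+1 c - (1 - c) `^ alpha| <= binq n.
Proof.
move=> c01; have [c0 c1] := andP c01; have [a0 _] := andP alpha01.
have [->|cn1] := eqVneq c 1.
  by rewrite binsum_at1 subrr powR0 ?gt_eqF// subr0 ger0_norm ?binq_ge0.
have [->|cn0] := eqVneq c 0.
  by rewrite binsum_at0 subr0 powR1 subrr normr0 binq_ge0.
have c01' : 0 < c < 1 by rewrite !lt_neqAle eq_sym cn0 cn1 c0.
have [cp cl] := andP c01'.
have /andP[lo _] := binsum_bounds n c01'.
rewrite ger0_norm ?subr_ge0// lerBlDl.
apply/ler_addgt0Pr => e e0.
have x0 : 0 < e * (1 - c) by rewrite mulr_gt0// subr_gt0.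
have /cvgrPdist_le/(_ _ x0) geo : geometric 1 c @ \oo --> (0 : R).
  by apply: cvg_geometric; rewrite ger0_norm.
near \oo => j.
have cj : c ^+ (n + j) <= e * (1 - c).
  rewrite -[leLHS]ger0_norm ?exprn_ge0// -normrN -[- _]add0r -[_ ^+ _]mul1r.
  near: j; case: geo => N _ hN; exists N => // j /= Nj.
  by apply: hN => /=; rewrite (leq_trans Nj)// leq_addl.
have := binsum_diff n j c01.
have /andP[_ hi] := binsum_bounds (n + j) c01'.
have : c ^+ (n + j) / (1 - c) <= e by rewrite ler_pdivrMr// subr_gt0.
have := binq_ge0 (n + j).
lra.
Unshelve. all: by end_near. Qed.

End BinomialSeries.

(** * Existence of the fractional Laplacian and of exponentials *)

Section Existence.
Variable R : realType.
Local Notation E := (ell2 R).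
Local Notation A := (@neg_laplacian R).

(** This operator is the mean of the identity and [averaging]. The factor [1/4] carries [[0, 4]]
    onto [[0, 1]], where the binomial sums converge uniformly. *)
Lemma opbd_quarter : opbd (fun f => f - 4^-1 *: A f) 1.
Proof.
move=> f; have -> : f - 4^-1 *: A f = 2^-1 *: (f + averaging f).
  by apply: ell2_ext => n; rewrite /averaging !ell2E; field.
rewrite nrmZ normc_nat_inv mul1r ler_pdivrMl// (le_trans (nrmD _ _))//.
rewrite mulr_natl mulr2n lerD2l.
by have := opbd_averaging f; rewrite mul1r.
Qed.

(* With [y = 1 - x / 4], [x^alpha = 4^alpha (1 - y)^alpha] is expanded in powers
   of [y]; [1 - A / 4] is a contraction, and the coefficients are absolutely
   summable. *)
Lemma funcalc_ex (alpha : R) : 0 < alpha < 1 ->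
  exists B, is_funcalc A (fun x => (x `^ alpha)%:C) B.
Proof.
move=> a01; have [a0 a1] := andP a01.
pose Y f : E := f - 4^-1 *: A f.
have lY : linear Y.
  by apply: linear_sub; [exact: linear_id|apply/linear_scale/linear_neg_laplacian].
pose b k : R := 4 `^ alpha * bincoef alpha k.
(* The tails of the sum of the moduli of [b]: the coefficient of index [0] contributes [1], and all
   the others together contribute [binq alpha 0 = 1], whence [2]. *)
pose tau k : R := 4 `^ alpha * (if k is j.+1 then binq alpha j else 2).
have bE k : normc (b k)%:C = tau k - tau k.+1.
  rewrite normc_real normrM ger0_norm ?powR_ge0// /tau -mulrBr; congr (_ * _).
  case: k => [|k] /=; first by rewrite normr1; ring.
  by rewrite ler0_norm ?opprB// subr_le0 (binq_leS a01).
have tau0 k : 0 <= tau k.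
  by rewrite /tau mulr_ge0 ?powR_ge0//; case: k => // k; exact: binq_ge0.
have binq0 : (fun k => 4 `^ alpha * binq alpha k) @ \oo --> (0 : R).
  by rewrite -(mulr0 (4 `^ alpha)); apply: cvgMr (binq_cvg0 a01).
have tau_cvg : tau @ \oo --> 0 by rewrite -cvg_shiftS.
pose T k f := (b k)%:C *: iter k Y f.
have lT k : linear (T k) by apply: linear_scale; exact: linear_iter.
have bT k : opbd (T k) (tau k - tau k.+1).
  rewrite -bE -[normc _]mulr1; apply: opbd_scale.
  by have := opbd_iter k ler01 opbd_quarter; rewrite expr1n.
have [B [lB [c c0 bB] cB]] := abs_cvg_series lT bT tau0 tau_cvg.
exists B; split; first exact: bounded_operatorI bB.
pose p n : {poly R[i]} := \sum_(k < n) (b k)%:C *: (1 - 4^-1 *: 'X) ^+ k.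
have pA n f : op_poly (p n) A f = \sum_(k < n) T k f.
  rewrite op_poly_sum; apply: eq_bigr => k _.
  by rewrite op_polyZ op_poly_affineX//; exact: linear_neg_laplacian.
exists p; split; last first.
  have lp n : linear (op_poly (p n) A).
    by apply: linear_op_poly; exact: linear_neg_laplacian.
  apply/(op_cvgP lp lB) => e /cB.
  by apply: filterS => n hn f; rewrite pA; exact: hn.
have pE n (x : R) : (p n).[x%:C] = (4 `^ alpha * binsum alpha n (1 - x / 4))%:C.
  rewrite horner_sum /binsum mulr_sumr rmorph_sum; apply: eq_bigr => k _.
  rewrite hornerZ horner_exp hornerD hornerN hornerC hornerZ hornerX mulrA.
  rewrite [RHS]rmorphM rmorphXn; congr (_ * _ ^+ _).
  by rewrite rmorphB rmorph1 rmorphM fmorphV rmorph_nat [in RHS]mulrC.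
move=> e e0; have /cvgrPdist_lt/(_ _ e0) := binq0.
(* The error of [p n.+1] is controlled by [binq alpha n], hence the shift by one. *)
case=> N _ hN; exists N.+1 => // -[//|n] /= Nn x /spectrum_neg_laplacian /andP[x0 x4].
have := hN n Nn; rewrite sub0r normrN ger0_norm ?mulr_ge0 ?powR_ge0 ?binq_ge0//.
apply: le_lt_trans.
rewrite pE -rmorphB normc_real.
have -> : x `^ alpha = 4 `^ alpha * (1 - (1 - x / 4)) `^ alpha.
  by rewrite subKr -powRM ?divr_ge0// mulrCA divff ?mulr1.
rewrite -mulrBr normrM ger0_norm ?powR_ge0// ler_wpM2l ?powR_ge0//.
apply: binsum_unif => //.
by rewrite subr_ge0 ler_pdivrMr// mul1r x4 gerBl divr_ge0.
Qed.

(** Existence rules out the default value [0] of [xget]. *)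
Lemma frac_laplacianP (alpha : R) : 0 < alpha < 1 ->
  is_funcalc A (fun x => (x `^ alpha)%:C) (frac_laplacian alpha).
Proof. by move=> /funcalc_ex [B hB]; exact: (xgetPex (fun=> 0) (ex_intro _ B hB)). Qed.

(** The scalar exponential series at a norm bound [c] of [B] dominates; its tails serve as [tau]. *)
Lemma op_expP (B : E -> E) : bounded_operator B -> is_op_exp B (op_exp B).
Proof.
move=> /bounded_operatorE[lB]; case=> c c0 bB.
suff [C hC] : exists C, is_op_exp B C by exact: (xgetPex (fun=> 0) (ex_intro _ C hC)).
pose L := limn (series (exp_coeff c)).
have scvg : series (exp_coeff c) @ \oo --> L by exact: is_cvg_series_exp_coeff.
pose tau k := L - series (exp_coeff c) k.
have tauE k : tau k - tau k.+1 = c ^+ k / k`!%:R.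
  have cancelE (a b d : R) : a - b - (a - (b + d)) = d by ring.
  by rewrite /tau /series/= big_nat_recr//= cancelE.
have sle : nondecreasing_seq (series (exp_coeff c)).
  apply/nondecreasing_seqP => n; rewrite -subr_ge0 /series/= big_nat_recr//=.
  by rewrite addrAC subrr add0r exp_coeff_ge0.
have tau0 k : 0 <= tau k.
  by rewrite subr_ge0; apply: nondecreasing_cvgn_le => //; apply/cvg_ex; exists L.
have tau_cvg : tau @ \oo --> 0.
  by rewrite -(subrr L); apply: cvgB => //; exact: cvg_cst.
pose T k f := (k`!%:R : R[i])^-1 *: iter k B f.
have lT k : linear (T k) by apply: linear_scale; exact: linear_iter.
have bT k : opbd (T k) (tau k - tau k.+1).
  rewrite tauE mulrC -normc_nat_inv; apply: opbd_scale.
  exact: opbd_iter k c0 bB.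
have [C [lC [d d0 bC] cC]] := abs_cvg_series lT bT tau0 tau_cvg.
exists C; split; first exact: bounded_operatorI bC.
have lS n : linear (fun f => \sum_(k < n) T k f).
  by apply: linear_bigsum => k; exact: lT.
exact/(op_cvgP lS lC).
Qed.

End Existence.

(** * Approximate eigenvectors *)

Section ApproximateEigenvectors.
Variable R : realType.
Local Notation E := (ell2 R).
Variable F : nat -> E.
Implicit Types (A B : E -> E) (z w : R[i]).

(** The error is relative to [nrm (F j)] because the truncated plane waves are not normalised. The
    sequence [F] is fixed, so that eigenvalues for the same [F] can be added, multiplied and passed
    to limits. *)
Definition approx_eigen B z := forall e : R, 0 < e ->
  \forall j \near \oo, nrm (B (F j) - z *: F j) <= e * nrm (F j).

Lemma approx_eigen_id : approx_eigen id 1.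
Proof.
move=> e e0; apply: nearW => j.
by rewrite scale1r subrr nrm0 mulr_ge0 ?nrm_ge0 ?ltW.
Qed.

Lemma approx_eigen_scale (c : R[i]) B z :
  approx_eigen B z -> approx_eigen (fun f => c *: B f) (c * z).
Proof.
move=> Bz e e0; have c1 : 0 < normc c + 1 by rewrite ltr_wpDl ?normc_ge0.
have := Bz _ (divr_gt0 e0 c1); apply: filterS => j hj.
rewrite -scalerA -scalerBr nrmZ.
apply: le_trans (ler_wpM2l (normc_ge0 c) hj) _.
rewrite mulrA ler_wpM2r ?nrm_ge0// mulrCA ger_pMr//.
by rewrite ler_pdivrMr// mul1r lerDl.
Qed.

Lemma approx_eigen_add A B z w :
  approx_eigen A z -> approx_eigen B w -> approx_eigen (fun f => A f + B f) (z + w).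
Proof.
move=> Az Bw e e0; have e20 : 0 < e / 2 by rewrite divr_gt0.
case: (Az _ e20) => M _ hM; case: (Bw _ e20) => N _ hN.
exists (maxn M N) => // j; rewrite /mkset geq_max => /andP[/hM k1 /hN k2].
rewrite scalerDl opprD addrACA; apply: le_trans (nrmD _ _) _.
apply: le_trans (lerD k1 k2) _.
by rewrite -mulrDl -splitr.
Qed.

Lemma approx_eigen_sum (n : nat) (T : nat -> E -> E) (z : nat -> R[i]) :
  (forall k, approx_eigen (T k) (z k)) ->
  approx_eigen (fun f => \sum_(k < n) T k f) (\sum_(k < n) z k).
Proof.
move=> Tz; elim: n => [|n ih].
  move=> e e0; apply: nearW => j.
  by rewrite !big_ord0 scale0r subrr nrm0 mulr_ge0 ?nrm_ge0 ?ltW.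
move=> e e0; have := approx_eigen_add ih (Tz n) e0.
by apply: filterS => j; rewrite !big_ord_recr.
Qed.

Lemma approx_eigen_comp A B (a : R) z w : linear A -> 0 <= a -> opbd A a ->
  approx_eigen A z -> approx_eigen B w -> approx_eigen (A \o B) (z * w).
Proof.
move=> lA a0 bA Az Bw e e0.
have e20 : 0 < e / 2 by rewrite divr_gt0.
have a1 : 0 < a + 1 by rewrite ltr_wpDl.
have w1 : 0 < normc w + 1 by rewrite ltr_wpDl ?normc_ge0.
case: (Az _ (divr_gt0 e20 w1)) => M _ hM.
case: (Bw _ (divr_gt0 e20 a1)) => N _ hN.
exists (maxn M N) => // j; rewrite /mkset geq_max => /andP[/hM k1 /hN k2].
rewrite /mkset in k1 k2.
have -> : (A \o B) (F j) - (z * w) *: F j =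
    A (B (F j) - w *: F j) + w *: (A (F j) - z *: F j).
  rewrite (linB lA) (linZ lA) scalerBr scalerA [w * z]mulrC addrA.
  by rewrite subrK.
apply: le_trans (nrmD _ _) _; rewrite nrmZ.
rewrite [leRHS](_ : _ = e / 2 * nrm (F j) + e / 2 * nrm (F j)); last first.
  by rewrite -mulrDl -splitr.
apply: lerD.
  apply: le_trans (bA _) _; apply: le_trans (ler_wpM2l a0 k2) _.
  rewrite mulrA ler_wpM2r ?nrm_ge0// mulrCA ger_pMr//.
  by rewrite ler_pdivrMr// mul1r lerDl.
apply: le_trans (ler_wpM2l (normc_ge0 w) k1) _.
rewrite mulrA ler_wpM2r ?nrm_ge0// mulrCA ger_pMr//.
by rewrite ler_pdivrMr// mul1r lerDl.
Qed.

Lemma approx_eigen_iter A (a : R) z k : linear A -> 0 <= a -> opbd A a ->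
  approx_eigen A z -> approx_eigen (iter k A) (z ^+ k).
Proof.
move=> lA a0 bA Az; elim: k => [|k ih]; first exact: approx_eigen_id.
by rewrite exprS; exact: (approx_eigen_comp lA a0 bA Az ih).
Qed.

Lemma approx_eigen_op_poly A (a : R) z p : linear A -> 0 <= a -> opbd A a ->
  approx_eigen A z -> approx_eigen (op_poly p A) p.[z].
Proof.
move=> lA a0 bA Az; rewrite horner_coef.
apply: (@approx_eigen_sum _ (fun k f => p`_k *: iter k A f) (fun k => p`_k * z ^+ k)).
by move=> k; apply: approx_eigen_scale; exact: (approx_eigen_iter k lA a0 bA Az).
Qed.

(** One error [e] each for replacing [B] by [T], for the residue of [T], and for replacing [z] by
    [w]. This quantitative form allows the propagator to be replaced by a single partial sum. *)
Lemma approx_eigen_near (T : E -> E) B z w (e : R) :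
  opbd (fun f => T f - B f) e -> normc (z - w) <= e -> approx_eigen T z ->
  0 < e -> \forall j \near \oo, nrm (B (F j) - w *: F j) <= 3 * e * nrm (F j).
Proof.
move=> TB zw Tz e0; have := Tz _ e0; apply: filterS => j hj.
have -> : B (F j) - w *: F j =
    - (T (F j) - B (F j)) + (T (F j) - z *: F j) + (z - w) *: F j.
  by apply: ell2_ext => n; rewrite !ell2E; ring.
apply: le_trans (nrmD _ _) _; rewrite nrmZ.
apply: le_trans (lerD (nrmD _ _) (ler_wpM2r (nrm_ge0 _) zw)) _; rewrite nrmN.
by have := TB (F j); lra.
Qed.

Lemma approx_eigen_lim (T : nat -> E -> E) B (z : nat -> R[i]) w :
  opcv T B -> (forall n, approx_eigen (T n) (z n)) ->
  (forall e : R, 0 < e -> \forall n \near \oo, normc (z n - w) <= e) ->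
  approx_eigen B w.
Proof.
move=> TB Tz zw e e0; have e30 : 0 < e / 3 by rewrite divr_gt0.
have h1 := TB _ e30; have h2 := zw _ e30; near \oo => n.
have -> : e = 3 * (e / 3) by field.
have k1 : opbd (fun f => T n f - B f) (e / 3) by near: n.
have k2 : normc (z n - w) <= e / 3 by near: n.
exact: approx_eigen_near k1 k2 (Tz n) e30.
Unshelve. all: by end_near. Qed.

(** A bounded inverse of [A - z] would bound [nrm (F j)] by a constant times the residue, which is
    arbitrarily small relative to it. Index [0] is left out because the empty plane wave
    vanishes. *)
Lemma approx_eigen_spectrum A z : (forall j, 0 < nrm (F j.+1)) ->
  approx_eigen A z -> spectrum A z.
Proof.
move=> F0 Az [G [bG GA _]].
have [lG bG'] := bounded_operatorE bG; case: bG' => c c0 bcG.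
have c1 : 0 < (2 * (c + 1))^-1 by rewrite invr_gt0 mulr_gt0// ltr_wpDl.
have [N _ /(_ N.+1 (leqnSn N))] := Az _ c1.
set j := N.+1 => h.
have := bcG (A (F j) - z *: F j); rewrite [G _]GA => le.
have := le_trans le (ler_wpM2l c0 h).
rewrite mulrA -[leLHS]mul1r (ler_pM2r (F0 N)) => {}le.
have : c * (2 * (c + 1))^-1 < 1.
  by rewrite ltr_pdivrMr ?mulr_gt0 ?ltr_wpDl// mul1r; lra.
by rewrite ltNge le.
Qed.

End ApproximateEigenvectors.

(** * Operators commuting with translations *)

Section TranslationInvariance.
Variable R : realType.
Local Notation E := (ell2 R).
Implicit Types (B T : E -> E).

Lemma translateB k (f g : E) : translate k (f - g) = translate k f - translate k g.
Proof. by apply: ell2_ext. Qed.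

Definition transl_inv B :=
  forall f, B (translate (- 1) f) = translate (- 1) (B f).

Lemma transl_inv_neg_laplacian : transl_inv (@neg_laplacian R).
Proof.
by move=> f; apply: ell2_ext => n; rewrite /= (addrAC n 1).
Qed.

Lemma transl_inv_iter B k : transl_inv B -> transl_inv (iter k B).
Proof. by move=> hB f; elim: k => //= k ->. Qed.

Lemma transl_inv_scale (a : R[i]) B :
  transl_inv B -> transl_inv (fun f => a *: B f).
Proof. by move=> hB f; rewrite hB; apply: ell2_ext => n. Qed.

Lemma transl_inv_sum (n : nat) (T : nat -> E -> E) :
  (forall k, transl_inv (T k)) -> transl_inv (fun f => \sum_(k < n) T k f).
Proof.
move=> hT f; apply: ell2_ext => m; rewrite ell2_sumE [RHS]ell2_sumE.
by apply: eq_bigr => k _; rewrite hT.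
Qed.

Lemma transl_inv_op_poly p B : transl_inv B -> transl_inv (op_poly p B).
Proof.
move=> hB; apply: (@transl_inv_sum _ (fun k f => p`_k *: iter k B f)) => k.
by apply: transl_inv_scale; exact: transl_inv_iter.
Qed.

Lemma transl_inv_lim (T : nat -> E -> E) B :
  opcv T B -> (forall n, transl_inv (T n)) -> transl_inv B.
Proof.
move=> TB hT f; apply/eqP; rewrite -subr_eq0; apply/eqP/nrm_small_eq0 => e e0.
have e20 : 0 < e / 2 by rewrite divr_gt0.
have h1 := opcv_cvg (translate (- 1) f) TB e20; have h2 := opcv_cvg f TB e20.
near \oo => n.
have k1 : nrm (T n (translate (- 1) f) - B (translate (- 1) f)) <= e / 2 by near: n.
have k2 : nrm (T n f - B f) <= e / 2 by near: n.
rewrite -(nrm_translate (- 1)) in k2.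
have -> : B (translate (- 1) f) - translate (- 1) (B f) =
   - (T n (translate (- 1) f) - B (translate (- 1) f)) + translate (- 1) (T n f - B f).
  by rewrite hT translateB; apply: ell2_ext => m; rewrite !ell2E; ring.
by rewrite (le_trans (nrmD _ _))// nrmN (splitr e) lerD.
Unshelve. all: by end_near. Qed.

Lemma translate_delta (k : int) : translate (- 1) (delta R k) = delta R (k + 1).
Proof. by apply: ell2_ext => n /=; rewrite subr_eq. Qed.

(** Such an operator acts as convolution with its value at [delta R 0]; this turns its action on a
    plane wave into a partial Fourier sum. *)
Lemma transl_inv_delta B (k : nat) n : transl_inv B ->
  B (delta R k) n = B (delta R 0) (n - k%:Z).
Proof.
move=> hB; elim: k n => [|k ih] n; first by rewrite subr0.
transitivity (B (delta R k) (n - 1)).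
  by rewrite -addn1 PoszD -translate_delta hB.
by rewrite ih -addn1 PoszD opprD addrAC addrA.
Qed.

End TranslationInvariance.

(** * Truncated plane waves *)

Section PlaneWaves.
Variable R : realType.
Local Notation E := (ell2 R).
Local Notation A := (@neg_laplacian R).
Implicit Types (u : R[i]) (B : E -> E).

Definition plane_wave u (j : nat) : E := \sum_(k < j) u ^+ k *: delta R k%:Z.

Lemma deltaE (k n : int) : delta R k n = (n == k)%:R.
Proof. by []. Qed.

Lemma neg_laplacian_delta (k : int) :
  A (delta R k) = 2 *: delta R k - delta R (k + 1) - delta R (k - 1).
Proof.
apply: ell2_ext => n; rewrite neg_laplacianE !ell2E !deltaE.
by rewrite [n - 1 == _]subr_eq [n == k - 1]eq_sym [k - 1 == _]subr_eq [k == _]eq_sym.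
Qed.

Lemma nrm_delta k : nrm (delta R k) <= 1.
Proof.
apply: nrm_leP => // s us; rewrite expr1n.
rewrite (eq_bigr (fun n => ((n == k) : nat)%:R)); last first.
  by move=> n _; rewrite deltaE; case: eqVneq => _; rewrite ?normc0 ?normc1 ?expr0n ?expr1n.
rewrite -natr_sum -big_mkcond/= sum1_count count_uniq_mem//.
by case: (_ \in _).
Qed.

Lemma plane_waveE u j (n : nat) : (n < j)%N -> plane_wave u j n = u ^+ n.
Proof.
move=> nj; rewrite ell2_sumE (bigD1 (Ordinal nj))// big1 => [|k kn].
  by rewrite ell2E deltaE eqxx mulr1 /= addr0.
rewrite ell2E deltaE eqz_nat (_ : (n == k)%N = false) ?mulr0//.
by apply: contra_neqF kn => /eqP nk; apply: val_inj.
Qed.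

Lemma nrm_plane_wave u j : normc u = 1 -> nrm (plane_wave u j) ^+ 2 = j%:R.
Proof.
move=> u1; apply/eqP; rewrite eq_le; apply/andP; split; last first.
  have us : uniq (map Posz (iota 0 j)) by rewrite map_inj_uniq ?iota_uniq// => ? ? [].
  apply: le_trans (sum_le_nrm (plane_wave u j) us).
  rewrite big_map (_ : iota 0 j = index_iota 0 j) ?big_mkord; last by rewrite /index_iota subn0.
  rewrite (eq_bigr (fun=> 1)) ?sumr_const ?card_ord//.
  by move=> k _; rewrite plane_waveE// normcX u1 !expr1n.
rewrite -[leRHS]sqr_sqrtr// ler_sqr ?nnegrE ?nrm_ge0 ?sqrtr_ge0//.
apply: nrm_leP => // s us; rewrite sqr_sqrtr//.
apply: (@le_trans _ _ (\sum_(n <- s) \sum_(k < j) (n == k%:Z)%:R)).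
  apply: ler_sum => n _.
  have [[k kn]|nk] := pselect (exists k : 'I_j, n = k%:Z).
    rewrite kn plane_waveE// normcX u1 !expr1n (bigD1 k)//= eqxx lerDl.
    exact: sumr_ge0.
  rewrite ell2_sumE big1 ?normc0 ?expr0n ?sumr_ge0// => k _.
  rewrite ell2E deltaE (_ : (n == k) = false) ?mulr0//.
  by apply/eqP => nk'; apply: nk; exists k.
rewrite exchange_big/= (_ : j%:R = \sum_(k < j) (1 : R)); last first.
  by rewrite sumr_const card_ord.
apply: ler_sum => k _.
rewrite -natr_sum -big_mkcond/= sum1_count count_uniq_mem//.
by case: (_ \in _).
Qed.

(** Inside the window the eigenvalue equation is exact; only the two ends contribute, with two terms
    each. *)
Lemma plane_wave_residue u j : u != 0 ->
  A (plane_wave u j) - (2 - u - u^-1) *: plane_wave u j =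
  u ^+ j *: delta R (j%:Z - 1) - (u^-1 * u ^+ j) *: delta R j +
  u^-1 *: delta R 0 - delta R (- 1).
Proof.
move=> u0; elim: j => [|j ih].
  rewrite /plane_wave big_ord0 (lin0 (@linear_neg_laplacian R)) scaler0 subr0.
  by apply: ell2_ext => n; rewrite expr0 mulr1 scale1r sub0r !ell2E deltaE; ring.
rewrite /plane_wave big_ord_recr/= -/(plane_wave u j).
rewrite (linD (@linear_neg_laplacian R)) (linZ (@linear_neg_laplacian R)).
rewrite scalerDr opprD addrACA ih neg_laplacian_delta -[j.+1]addn1 PoszD addrK.
by apply: ell2_ext => n; rewrite !ell2E exprD expr1; field.
Qed.

Lemma approx_eigen_plane_wave u : normc u = 1 ->
  approx_eigen (plane_wave u) A (2 - u - u^-1).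
Proof.
move=> u1 e e0.
have u0 : u != 0 by apply: contra_eq_neq u1 => ->; rewrite normc0 eq_sym oner_eq0.
(* The residue has norm at most [4] and the plane wave has norm [sqrt j], so [j >= 16 / e ^+ 2]
   suffices. *)
have [N _ hN] := nbhs_infty_ger (16 / e ^+ 2 : R).
exists N => // j /hN; rewrite /mkset ler_pdivrMr ?exprn_gt0// => hj.
have le4 : 4 <= e * nrm (plane_wave u j).
  rewrite -ler_sqr ?nnegrE ?mulr_ge0 ?nrm_ge0 ?(ltW e0)//.
  rewrite exprMn nrm_plane_wave// mulrC; apply: le_trans hj.
  by rewrite -natrX.
apply: le_trans le4; rewrite plane_wave_residue//.
have bnd (z : R[i]) k : normc z = 1 -> nrm (z *: delta R k) <= 1.
  by move=> z1; rewrite nrmZ z1 mul1r nrm_delta.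
have v1 : normc u^-1 = 1 by rewrite normcV u1 invr1.
have uj : normc (u ^+ j) = 1 by rewrite normcX u1 expr1n.
have d1 := bnd (u ^+ j) (j%:Z - 1) uj.
have d2 : nrm ((u^-1 * u ^+ j) *: delta R j) <= 1 by apply: bnd; rewrite normcM v1 uj mulr1.
have d3 := bnd u^-1 0 v1.
have d4 := nrm_delta (- 1).
apply: le_trans (nrmD _ _) _; rewrite nrmN.
apply: le_trans (lerD (nrmD _ _) (lexx _)) _.
apply: le_trans (lerD (lerD (nrmD _ _) (lexx _)) (lexx _)) _; rewrite nrmN.
lra.
Qed.

Lemma transl_inv_plane_wave B u j n : linear B -> transl_inv B ->
  B (plane_wave u j) n = \sum_(k < j) u ^+ k * B (delta R 0) (n - k%:Z).
Proof.
move=> lB tB; rewrite /plane_wave (lin_sum lB) ell2_sumE.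
by apply: eq_bigr => k _; rewrite (linZ lB) ell2E transl_inv_delta.
Qed.

(* Both residues have mean square at most [e^2] over the window [0, j), so a
   common site [n] where both are small exists. *)
Lemma common_window B u w z (j : nat) (e : R) : linear B -> transl_inv B ->
  (0 < j)%N -> 0 < e -> normc u = 1 -> normc w = 1 ->
  nrm (B (plane_wave u j) - z *: plane_wave u j) <= e * nrm (plane_wave u j) ->
  nrm (B (plane_wave w j) - plane_wave w j) <= e * nrm (plane_wave w j) ->
  exists n : nat,
   normc (\sum_(k < j) u ^+ k * B (delta R 0) (n%:Z - k%:Z) - z * u ^+ n) <= 2 * e /\
   normc (\sum_(k < j) w ^+ k * B (delta R 0) (n%:Z - k%:Z) - w ^+ n) <= 2 * e.
Proof.
move=> lB tB j0 e0 u1 w1 hu hw.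
pose a v y n : R := normc ((B (plane_wave v j) - y *: plane_wave v j) n).
have aE v y (n : nat) : (n < j)%N ->
    a v y n = normc (\sum_(k < j) v ^+ k * B (delta R 0) (n%:Z - k%:Z) - y * v ^+ n).
  by move=> nj; rewrite /a !ell2E transl_inv_plane_wave// plane_waveE.
have S v y : normc v = 1 ->
    nrm (B (plane_wave v j) - y *: plane_wave v j) <= e * nrm (plane_wave v j) ->
    \sum_(n < j) a v y n ^+ 2 <= e ^+ 2 * j%:R.
  move=> v1 hv; have us : uniq (map Posz (iota 0 j)).
    by rewrite map_inj_uniq ?iota_uniq// => ? ? [].
  have := sum_le_nrm (B (plane_wave v j) - y *: plane_wave v j) us.
  rewrite big_map (_ : iota 0 j = index_iota 0 j) ?big_mkord; last by rewrite /index_iota subn0.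
  move=> /le_trans; apply.
  apply: (@le_trans _ _ ((e * nrm (plane_wave v j)) ^+ 2)); last first.
    by rewrite exprMn nrm_plane_wave.
  have p1 := nrm_ge0 (B (plane_wave v j) - y *: plane_wave v j).
  have p2 := mulr_ge0 (ltW e0) (nrm_ge0 (plane_wave v j)).
  by rewrite ler_sqr ?nnegrE.
have Su := S u z u1 hu; have Sw := S w 1 w1; rewrite scale1r in Sw.
have {Sw} := Sw hw => Sw; have := lerD Su Sw; rewrite -big_split/= => sum_le.
have [[n /andP[n1 n2]]|none] := pselect (exists n : 'I_j,
    (a u z n <= 2 * e) && (a w 1 n <= 2 * e)).
  have nj := ltn_ord n.
  by exists n; split; [rewrite -aE|rewrite -[w ^+ n]mul1r -aE].
(* Without a good site each of the [j] sites contributes at least [(2 * e) ^+ 2], while the total is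
   at most [2 * e ^+ 2 * j]; this is the origin of the factor [2] in the conclusion. *)
have : \sum_(n < j) (4 * e ^+ 2) <= \sum_(n < j) (a u z n ^+ 2 + a w 1 n ^+ 2).
  apply: ler_sum => n _.
  have sq v y : 2 * e < a v y n -> 4 * e ^+ 2 <= a v y n ^+ 2.
    move=> /ltW h; rewrite (_ : 4 * _ = (2 * e) ^+ 2); last by ring.
    by rewrite ler_sqr ?nnegrE ?normc_ge0 ?mulr_ge0 ?(ltW e0).
  have : ~~ ((a u z n <= 2 * e) && (a w 1 n <= 2 * e)).
    by apply/negP => h; apply: none; exists n.
  rewrite negb_and -!ltNge => /orP[/sq h|/sq h]; rewrite (le_trans h)//.
    by rewrite lerDl sqr_ge0.
  by rewrite lerDr sqr_ge0.
rewrite sumr_const card_ord -[_ *+ _]mulr_natr => /le_trans/(_ sum_le).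
rewrite -mulrDl ler_pM2r ?ltr0n//.
by have := exprn_gt0 2 e0; move: (e ^+ 2) => x; clear; lra.
Qed.

End PlaneWaves.

(** * Half-Hoelder regularity from a finite second moment *)

Section FractionalRegularity.
Variable R : realType.
Implicit Types (psi : int -> R[i]).

Lemma sub_uniq_sum (I : eqType) (s r : seq I) (F : I -> R) :
  uniq s -> {subset s <= r} -> (forall i, 0 <= F i) ->
  \sum_(i <- s) F i <= \sum_(i <- r) F i.
Proof.
move=> + + F0; elim: s r => [|x s ih] r /=.
  by rewrite big_nil sumr_ge0.
move=> /andP[xs us] sr.
have xr : x \in r by apply: sr; rewrite mem_head.
rewrite (perm_big _ (perm_to_rem xr)) !big_cons lerD2l ih// => y ys.
have : y \in x :: rem x r by rewrite -(perm_mem (perm_to_rem xr)) sr// in_cons ys orbT.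
by rewrite in_cons => /orP[/eqP yx|//]; rewrite -yx ys in xs.
Qed.

(* The weights [min(2, k d) / k]; the square sum is at most [5 d] because the
   terms with [k <= 1 / d] contribute [d] and those with [k > 1 / d] contribute
   [4 d]. At [k = 0] the weight is [0 / 0 = 0]. *)
Definition weight (d : R) (k : nat) : R := Num.min 2 (k%:R * d) / k%:R.

Lemma weight_ge0 d k : 0 <= d -> 0 <= weight d k.
Proof. by move=> d0; rewrite divr_ge0// le_min mulr_ge0// ler0n. Qed.

(** Taking [d = 1 / K] places the change of regime at the integer [K]. Beyond it,
    [1 / (x + 1)^2 <= 1 / x - 1 / (x + 1)] telescopes. *)
Lemma sum_weight_nat (K L : nat) : (0 < K)%N ->
  \sum_(k < L) weight K%:R^-1 k ^+ 2 <= 5 * K%:R^-1.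
Proof.
move=> K0; set d := K%:R^-1.
have Kp : 0 < K%:R :> R by rewrite ltr0n.
have d0 : 0 < d by rewrite invr_gt0.
have w0 k := weight_ge0 k (ltW d0).
have w1 k : weight d k <= d.
  have [->|k0] := posnP k; first by rewrite /weight invr0 mulr0 ltW.
  by rewrite ler_pdivrMr ?ltr0n// ge_min mulrC lexx orbT.
have w2 k : weight d k <= 2 / k%:R.
  by rewrite ler_wpM2r ?invr_ge0// ge_min lexx.
have low n : \sum_(k < n.+1) weight d k ^+ 2 <= n%:R * d ^+ 2.
  elim: n => [|n ih].
    by rewrite big_ord1 /weight invr0 mulr0 expr0n mul0r.
  rewrite big_ord_recr/= -[n.+1%:R]natr1 mulrDl mul1r lerD//.
  by rewrite ler_sqr ?nnegrE// ltW.
have telescope (x : R) : 0 < x -> (2 / (x + 1)) ^+ 2 <= 4 * (x^-1 - (x + 1)^-1).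
  move=> x0; rewrite -subr_ge0 [leRHS](_ : _ = 4 / (x * (x + 1) ^+ 2)).
    by rewrite divr_ge0// mulr_ge0 ?sqr_ge0// ltW.
  by field; rewrite !gt_eqF// addr_gt0.
have high j : \sum_(k < (K + j).+1) weight d k ^+ 2 <= d + 4 * (d - (K + j)%:R^-1).
  elim: j => [|j ih].
    rewrite addn0 subrr mulr0 addr0; apply: le_trans (low K) _.
    by rewrite expr2 mulrA mulfV ?mul1r// gt_eqF.
  rewrite addnS big_ord_recr/=; apply: le_trans (lerD ih (lexx _)) _.
  set x : R := (K + j)%:R.
  have x0 : 0 < x by rewrite ltr0n ltn_addr.
  have xE : (K + j).+1%:R = x + 1 by rewrite natr1.
  have := w2 (K + j).+1; rewrite xE => h.
  have h2 : weight d (K + j).+1 ^+ 2 <= (2 / (x + 1)) ^+ 2.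
    have x1 : 0 <= 2 / (x + 1) by rewrite divr_ge0// addr_ge0// ltW.
    by rewrite ler_sqr ?nnegrE ?w0.
  have h3 := telescope x x0.
  by have := le_trans h2 h3; lra.
have [LK|KL] := leqP L K.
  have : \sum_(k < L) weight d k ^+ 2 <= \sum_(k < K.+1) weight d k ^+ 2.
    rewrite -!(big_mkord xpredT (fun k => weight d k ^+ 2)).
    apply: sub_uniq_sum => [|k|k]; rewrite ?iota_uniq ?sqr_ge0//.
    by rewrite !mem_index_iota !leq0n/= => /leq_trans; apply; rewrite leqW.
  move=> /le_trans; apply; have := high 0%N; rewrite addn0 => /le_trans; apply.
  by rewrite /d subrr; move: d0; rewrite /d; lra.
rewrite -(subnKC KL) addSn; apply: le_trans (high _) _.
have : 0 <= (K + (L - K.+1))%:R^-1 :> R by rewrite invr_ge0.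
by lra.
Qed.

(** The absolute value is injective on the nonnegative and on the negative integers separately, and
    each half costs [5 / K]. *)
Lemma sum_weight (K : nat) (s : seq int) : (0 < K)%N -> uniq s ->
  \sum_(m <- s) weight K%:R^-1 `|m|%N ^+ 2 <= 10 * K%:R^-1.
Proof.
move=> K0 us; pose F k := weight K%:R^-1 k ^+ 2 : R.
have bound (P : pred int) : {in P &, injective absz} ->
    \sum_(m <- s | P m) F `|m|%N <= 5 * K%:R^-1.
  move=> injP; rewrite -big_filter.
  rewrite -(big_map absz xpredT F); set r := map _ _.
  have ur : uniq r.
    rewrite map_inj_in_uniq ?filter_uniq// => x y.
    by rewrite !mem_filter => /andP[Px _] /andP[Py _]; exact: injP.
  apply: le_trans (sum_weight_nat (\max_(k <- r) k).+1 K0).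
  rewrite -(big_mkord xpredT F).
  apply: sub_uniq_sum => // [k kr|k]; last exact: sqr_ge0.
  by rewrite mem_index_iota/= ltnS; apply: (@leq_bigmax_seq _ _ xpredT id).
rewrite (bigID (fun m : int => 0 <= m))/=.
have -> : 10 * K%:R^-1 = 5 * K%:R^-1 + 5 * K%:R^-1 :> R by ring.
apply: lerD; apply: bound => x y; rewrite !unfold_in/=.
  by move=> x0 y0 xy; rewrite -(gez0_abs x0) -(gez0_abs y0) xy.
rewrite -!ltNge => x0 y0 xy; apply: oppr_inj.
by rewrite -(ltz0_abs x0) -(ltz0_abs y0) xy.
Qed.

Lemma normc_position psi m : normc (position psi m) = `|m|%N%:R * normc (psi m).
Proof.
rewrite /position normcM; congr (_ * _).
by rewrite -(rmorph_int (real_complex R)) normc_real -intr_norm -abszE.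
Qed.

(** A finite set [X] whose sum is within [eta] of the supremum leaves at most [eta] to any finite
    set disjoint from it. *)
Lemma sqnorm_tail psi (eta : R) : (sqnorm psi < +oo)%E -> 0 < eta ->
  exists X : seq int, forall s, uniq s -> {in s, forall m, m \notin X} ->
    \sum_(m <- s) normc (psi m) ^+ 2 <= eta.
Proof.
move=> psi2 eta0.
have fin : sqnorm psi \is a fin_num by rewrite ge0_fin_numE ?sqnorm_ge0.
have : (sqnorm psi - eta%:E < sqnorm psi)%E.
  by rewrite lteBlDr// lteDl// lte_fin.
move=> /ereal_sup_gt[_ [Y [finY _] <-]].
rewrite fsbig_finite// sumEFin => Ygt.
have uX : uniq (finmap.enum_fset (fset_set Y)) by exact: finmap.fset_uniq.
exists (finmap.enum_fset (fset_set Y)) => s us sY.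
have ucat : uniq (s ++ finmap.enum_fset (fset_set Y)).
  rewrite cat_uniq us uX andbT/=.
  by apply/hasPn => m mY; apply/negP => /sY; rewrite mY.
have := sum_le_sqnorm psi ucat; rewrite big_cat/=.
move: Ygt; rewrite -(fineK fin) -EFinB lte_fin lee_fin.
by lra.
Qed.

(* A sequence with [m psi(m)] in [l2] has a Fourier transform in [H^1], hence
   little-o Hoelder continuous of exponent [1/2]. *)
Lemma half_holder psi (c : R) : (sqnorm (position psi) < +oo)%E -> 0 < c ->
  \forall K \near \oo, forall s : seq int, uniq s ->
    \sum_(m <- s) normc (psi m) * Num.min 2 (`|m|%N%:R * K%:R^-1)
      <= c * Num.sqrt K%:R^-1.
Proof.
move=> fin c0.
have eta0 : 0 < c ^+ 2 / 40 by rewrite divr_gt0 ?exprn_gt0.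
have [X tail] := sqnorm_tail fin eta0.
pose a m : R := normc (position psi m).
pose S := \sum_(m <- X) a m.
have S0 : 0 <= S by apply: sumr_ge0 => m _; exact: normc_ge0.
(* On [X] the sum is at most [S * d]; this threshold makes it at most half of [c * sqrt d]. *)
have [N _ hN] := nbhs_infty_ger ((2 * (S + 1) / c) ^+ 2).
exists N.+1 => // K /= NK s us.
have K0 : (0 < K)%N by rewrite (leq_trans _ NK).
have Kp : 0 < K%:R :> R by rewrite ltr0n.
set d := K%:R^-1.
have d0 : 0 < d by rewrite invr_gt0.
set e := Num.sqrt d.
have e0 : 0 < e by rewrite sqrtr_gt0.
have e2 : e ^+ 2 = d by rewrite sqr_sqrtr// ltW.
pose G m : R := normc (psi m) * Num.min 2 (`|m|%N%:R * d).
have GE m : G m = a m * weight d `|m|%N.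
  rewrite /G /a normc_position /weight; have [->|m0] := eqVneq m 0.
    by rewrite absz0 !mul0r (_ : Num.min 2 0 = 0) ?mulr0//; apply/min_idPr.
  have m1 : `|m|%N%:R != 0 :> R by rewrite pnatr_eq0 absz_eq0.
  by move: (Num.min _ _) => w; field.
have G0 m : 0 <= G m by rewrite GE mulr_ge0 ?normc_ge0 ?weight_ge0 ?ltW.
rewrite -/(\sum_(m <- s) G m) (bigID (mem X))/=.
have part1 : \sum_(m <- s | m \in X) G m <= c / 2 * e.
  rewrite -big_filter.
  apply: (@le_trans _ _ (\sum_(m <- X) G m)).
    by apply: sub_uniq_sum; rewrite ?filter_uniq// => m; rewrite mem_filter => /andP[].
  apply: (@le_trans _ _ (S * d)).
    rewrite /S mulr_suml; apply: ler_sum => m _.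
    rewrite /G /a normc_position mulrAC [leRHS]mulrC ler_wpM2l ?normc_ge0//.
    by rewrite ge_min lexx orbT.
  have Se : 2 * (S + 1) * e <= c.
    have S1 : 0 <= 2 * (S + 1) by rewrite mulr_ge0// addr_ge0.
    have S2 := mulr_ge0 S1 (ltW e0).
    rewrite -ler_sqr ?nnegrE ?S2 ?(ltW c0)//.
    have /hN : (N <= K)%N by rewrite ltnW.
    rewrite /mkset exprMn exprVn ler_pdivrMr ?exprn_gt0// => h.
    by rewrite exprMn e2 /d ler_pdivrMr// [leRHS]mulrC.
  have -> : S * d = S * e * e by rewrite -mulrA -expr2 e2.
  rewrite ler_wpM2r ?(ltW e0)//.
  by have := mulr_ge0 S0 (ltW e0); move: Se e0; clear; nra.
have part2 : \sum_(m <- s | m \notin X) G m <= c / 2 * e.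
  rewrite -big_filter; set r := seq.filter _ _.
  have ur : uniq r by exact: filter_uniq.
  have rX : {in r, forall m, m \notin X} by move=> m; rewrite mem_filter => /andP[].
  have T1 := tail r ur rX.
  have T2 := sum_weight K0 ur; rewrite -/d in T2.
  (* The parameter of a Young inequality used in place of Cauchy-Schwarz. With tail [c ^+ 2 / 40]
     and weight sum [10 * d], both resulting terms equal [c * e / 4]. *)
  pose sg := 20 * e / c.
  have sg0 : 0 < sg by rewrite divr_gt0// mulr_gt0.
  apply: (@le_trans _ _ (\sum_(m <- r) (sg / 2 * a m ^+ 2 +
                          (2 * sg)^-1 * weight d `|m|%N ^+ 2))).
    apply: ler_sum => m _; rewrite GE; move: (a m) (weight _ _) => x y.
    rewrite -subr_ge0 [leRHS](_ : _ = (sg * x - y) ^+ 2 / (2 * sg)).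
      by apply: divr_ge0; [exact: sqr_ge0|rewrite mulr_ge0// (ltW sg0)].
    by field; rewrite gt_eqF.
  rewrite big_split/= -!mulr_sumr.
  have h1 : 0 <= sg / 2 by rewrite divr_ge0// (ltW sg0).
  have h2 : 0 <= (2 * sg)^-1 by rewrite invr_ge0 mulr_ge0// (ltW sg0).
  apply: le_trans (lerD (ler_wpM2l h1 T1) (ler_wpM2l h2 T2)) _.
  have fE (x y : R) : 0 < x -> 0 < y ->
      20 * x / y / 2 * (y ^+ 2 / 40) + (2 * (20 * x / y))^-1 * (10 * x ^+ 2) = y / 2 * x.
    by move=> x0 y0; field; rewrite !gt_eqF.
  by rewrite -[d]e2 fE.
by have := lerD part1 part2; rewrite -mulrDl -splitr.
Qed.

End FractionalRegularity.

(** * The propagator *)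

Section Propagator.
Variable R : realType.
Local Notation E := (ell2 R).
Local Notation A := (@neg_laplacian R).
Implicit Types (u z : R[i]).

Definition exp_partial n z : R[i] := \sum_(k < n) (k`!%:R)^-1 * z ^+ k.

Lemma exp_partial0 n : exp_partial n.+1 0 = 1.
Proof.
rewrite /exp_partial big_ord_recl/= expr0 invr1 mulr1 big1 ?addr0// => k _.
by rewrite expr0n mulr0.
Qed.

Lemma exp_partial_lower n z : normc z <= 2^-1 ->
  normc z / 2 <= normc (exp_partial n.+2 z - 1).
Proof.
move=> z2; have z0 := normc_ge0 z.
(* The factor [1 - 2^-n] makes the induction close: the next term is at most [|z|^2 2^-(n + 1)], as
   [|z| <= 1/2] and the factorial is at least [2]. *)
have rem : normc (exp_partial n.+2 z - 1 - z) <= normc z ^+ 2 * (1 - 2^-1 ^+ n).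
  elim: n => [|n ih].
    rewrite /exp_partial big_ord_recr big_ord1/= !expr0 expr1 !invr1 !mul1r.
    by rewrite addrAC addrK subrr normc0 subrr mulr0.
  have -> : exp_partial n.+3 z - 1 - z =
      exp_partial n.+2 z - 1 - z + (n.+2`!%:R)^-1 * z ^+ n.+2.
    rewrite {1}/exp_partial big_ord_recr/= -/(exp_partial n.+2 z).
    by move: (exp_partial _ _) (_^-1 * _) => P Q; ring.
  apply: le_trans (le_normcD _ _) _; apply: le_trans (lerD ih (lexx _)) _.
  rewrite normcM normc_nat_inv normcX.
  set q : R := 2^-1 ^+ n; set x := normc z in z0 z2 *.
  have f2 : (n.+2`!%:R)^-1 <= 2^-1 :> R.
    rewrite lef_pV2 ?posrE ?ltr0n ?fact_gt0// ler_nat.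
    by rewrite factS (leq_trans _ (leq_pmulr _ (fact_gt0 _))).
  have xq : x ^+ n.+2 <= x ^+ 2 * q.
    by rewrite -addn2 exprD mulrC ler_wpM2l ?sqr_ge0// lerXn2r ?nnegrE ?invr_ge0.
  have fac0 : 0 <= (n.+2`!%:R)^-1 :> R by rewrite invr_ge0.
  have := ler_pM fac0 (exprn_ge0 n.+2 z0) f2 xq.
  rewrite [2^-1 ^+ n.+1]exprS -/q; move: (x ^+ 2) (_ * x ^+ n.+2) => X Y.
  by move=> h; apply: le_trans (lerD (lexx _) h) _; lra.
have sq : normc z ^+ 2 * (1 - 2^-1 ^+ n) <= normc z / 2.
  rewrite expr2 -mulrA ler_wpM2l//; have q0 : 0 <= (2^-1 : R) ^+ n by rewrite exprn_ge0 ?invr_ge0.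
  apply: le_trans z2; rewrite -[leRHS]mulr1 ler_wpM2l// gerBl//.
have := le_normcD (exp_partial n.+2 z - 1) (z - (exp_partial n.+2 z - 1)).
rewrite addrC subrK normcB => tri.
have := le_trans rem sq; move: tri; move: (normc z) (normc _) (normc _) => x y w.
by lra.
Qed.

(** On the unit circle [|u - 1|^2] and [2 - u - 1/u] are both [2 - 2 Re u], which forces the real
    part [1 - d^2 / 2]. The chord [d], rather than an angle, is the parameter. *)
Lemma circle_point (d : R) : 0 <= d <= 1 -> exists u,
  [/\ normc u = 1, normc (u - 1) = d & 2 - u - u^-1 = (d ^+ 2)%:C].
Proof.
move=> /andP[d0 d1]; pose a := 1 - d ^+ 2 / 2.
have d2 : 0 <= d ^+ 2 <= 1 by rewrite sqr_ge0 expr_le1.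
have a2 : 0 <= 1 - a ^+ 2.
  by rewrite /a; move: d2; move: (d ^+ 2) => x /andP[]; nra.
pose b := Num.sqrt (1 - a ^+ 2).
have b2 : b ^+ 2 = 1 - a ^+ 2 by rewrite sqr_sqrtr.
exists (a +i* b).
have ab : (a +i* b) * (a -i* b) = 1.
  by apply/eqP; rewrite eq_complex/=; apply/andP; split; apply/eqP; nra.
have v : (a +i* b)^-1 = a -i* b.
  have u0 : a +i* b != 0.
    by apply: contra_eq_neq ab => ->; rewrite mul0r eq_sym oner_eq0.
  by apply: (mulfI u0); rewrite ab mulfV.
have sq x : 0 <= x -> x ^+ 2 = d ^+ 2 -> x = d.
  by move=> x0 /eqP; rewrite eqrXn2// => /eqP.
split.
- by apply/eqP; rewrite -(@eqrXn2 _ 2)// ?normc_ge0// normc_sqr/= b2 expr1n addrC subrK.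
- by apply: sq; rewrite ?normc_ge0// normc_sqr/= subr0 b2 /a; field.
- by rewrite v; apply/eqP; rewrite eq_complex/=; apply/andP; split; apply/eqP;
    rewrite /a; field.
Qed.

Lemma dist_powers u (a b : nat) : normc u = 1 ->
  normc (u ^+ a - u ^+ b) <=
    Num.min 2 (`|a%:Z - b%:Z|%N%:R * normc (u - 1)).
Proof.
move=> u1.
have uX n : normc (u ^+ n) = 1 by rewrite normcX u1 expr1n.
have step n : normc (u ^+ n - 1) <= n%:R * normc (u - 1).
  elim: n => [|n ih]; first by rewrite expr0 subrr normc0 mul0r.
  have -> : u ^+ n.+1 - 1 = u * (u ^+ n - 1) + (u - 1) by rewrite exprS; ring.
  apply: le_trans (le_normcD _ _) _; rewrite normcM u1 mul1r -natr1 mulrDl mul1r.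
  by rewrite lerD2r.
rewrite le_min; apply/andP; split.
  by apply: le_trans (le_normcD _ _) _; rewrite normcN !uX.
wlog ab : a b / (a <= b)%N.
  move=> h; have [/h//|/ltnW/h] := leqP a b.
  by rewrite normcB distnC.
rewrite -(subnKC ab) exprD -{1}[u ^+ a]mulr1 -mulrBr normcM uX mul1r normcB.
rewrite (_ : `|a%:Z - _|%N = (b - a)%N); first exact: step.
by rewrite subnKC// distnEr.
Qed.

Section Alpha.
Variable alpha : R.
Hypothesis alpha01 : 0 < alpha < 1.
Local Notation H := (frac_laplacian alpha).
Variable t : R.
Let itH (f : E) : E := (0 +i* t) *: H f.

Lemma bounded_frac_laplacian : bounded_operator H.
Proof. by have [] := frac_laplacianP alpha01. Qed.

Lemma bounded_itH : bounded_operator itH.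
Proof.
have [lH [c c0 bH]] := bounded_operatorE bounded_frac_laplacian.
apply: (@bounded_operatorI _ _ (normc (0 +i* t) * c)).
- exact: linear_scale.
- by rewrite mulr_ge0 ?normc_ge0.
- exact: opbd_scale.
Qed.

Lemma propagatorP : [/\ linear (propagator t H),
  opcv (fun n f => \sum_(k < n) (k`!%:R)^-1 *: iter k itH f) (propagator t H) &
  transl_inv (propagator t H)].
Proof.
have [lH bH] := bounded_operatorE bounded_frac_laplacian.
have [litH _] := bounded_operatorE bounded_itH.
have [bU cU] := op_expP bounded_itH.
have [lU _] := bounded_operatorE bU.
have lT n : linear (fun f => \sum_(k < n) (k`!%:R : R[i])^-1 *: iter k itH f).
  by apply: linear_bigsum => k; apply: linear_scale; exact: linear_iter.
have {}cU := (op_cvgP lT lU).1 cU.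
split=> //; apply: (transl_inv_lim cU) => n.
apply: (@transl_inv_sum _ n (fun k f => (k`!%:R)^-1 *: iter k itH f)) => k.
apply: transl_inv_scale; apply: transl_inv_iter; apply: transl_inv_scale.
have [_ [p [_ cp]]] := frac_laplacianP alpha01.
have lp m : linear (op_poly (p m) A).
  by apply: linear_op_poly; exact: linear_neg_laplacian.
have {}cp := (op_cvgP lp lH).1 cp.
apply: (transl_inv_lim cp) => m; apply: transl_inv_op_poly.
exact: transl_inv_neg_laplacian.
Qed.

Lemma approx_eigen_exp_partial u (x : R) n : normc u = 1 -> 2 - u - u^-1 = x%:C ->
  approx_eigen (plane_wave u) (fun f => \sum_(k < n) (k`!%:R)^-1 *: iter k itH f)
    (exp_partial n ((0 +i* t) * (x `^ alpha)%:C)).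
Proof.
move=> u1 ux.
have Ax := approx_eigen_plane_wave u1; rewrite ux in Ax.
(* The approximating polynomials are known to converge to [x^alpha] only on the spectrum. *)
have xA : spectrum A x%:C.
  apply: approx_eigen_spectrum Ax => j.
  rewrite lt_neqAle nrm_ge0 andbT eq_sym; apply/eqP => n0.
  have := nrm_plane_wave j.+1 u1; rewrite n0 expr0n/= => /esym/eqP.
  by rewrite pnatr_eq0.
have [lH [h h0 bH]] := bounded_operatorE bounded_frac_laplacian.
have [litH [c c0 bitH]] := bounded_operatorE bounded_itH.
have lA := @linear_neg_laplacian R.
have [_ [p [pu cp]]] := frac_laplacianP alpha01.
have lp m : linear (op_poly (p m) A) by exact: linear_op_poly.
have {}cp := (op_cvgP lp lH).1 cp.
have Hx : approx_eigen (plane_wave u) H (x `^ alpha)%:C.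
  apply: (approx_eigen_lim cp (z := fun n => (p n).[x%:C])) => [m|e e0].
    exact: (approx_eigen_op_poly (p m) lA (ler0n R 4) (@opbd_neg_laplacian R) Ax).
  by have := pu e e0; apply: filterS => m /(_ x xA)/ltW.
apply: (@approx_eigen_sum _ _ n (fun k f => (k`!%:R)^-1 *: iter k itH f)
  (fun k => (k`!%:R)^-1 * ((0 +i* t) * (x `^ alpha)%:C) ^+ k)) => k.
apply: approx_eigen_scale; apply: (approx_eigen_iter k litH c0 bitH).
exact: approx_eigen_scale.
Qed.

End Alpha.

End Propagator.

(** The first bound is where [alpha <= 1/4] enters: [d^(2 alpha) >= d^(1/2)] for [d <= 1]. The
    second brings the exponent into the range where the linear term of the exponential dominates. *)
Lemma frac_power_bounds (R : realType) (alpha t : R) : 0 < alpha <= 4^-1 ->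
  \forall K \near \oo,
    let x := (K%:R^-1 : R) ^+ 2 in
    Num.sqrt K%:R^-1 <= x `^ alpha /\ `|t| * x `^ alpha <= 2^-1.
Proof.
move=> /andP[a0 a4]; pose b : R := (2 * (`|t| + 1))^-1.
have t1 : 0 < `|t| + 1 by rewrite ltr_wpDl.
have b0 : 0 < b by rewrite invr_gt0 mulr_gt0.
pose y := b `^ (alpha^-1).
have y0 : 0 < y by exact: powR_gt0.
have ya : y `^ alpha = b by rewrite -powRrM mulVf ?gt_eqF// powRr1// ltW.
have [N _ hN] := nbhs_infty_ger (y^-1).
exists N.+1 => // K /= NK.
have K0 : (0 < K)%N by rewrite (leq_trans _ NK).
have Kp : 0 < K%:R :> R by rewrite ltr0n.
have K1 : 1 <= K%:R :> R by rewrite ler1n.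
set d : R := K%:R^-1.
have d0 : 0 < d by rewrite invr_gt0.
have d1 : d <= 1 by rewrite invf_le1.
have dd : d ^+ 2 <= d by rewrite expr2 ler_piMr// ltW.
split.
  have -> : Num.sqrt d = (d ^+ 2) `^ 4^-1.
    rewrite -powR12_sqrt ?ltW// -powR_mulrn ?ltW// -powRrM; congr (_ `^ _).
    by field.
  apply: ger_powR => //.
  by rewrite exprn_gt0//= (le_trans dd).
have xb : (d ^+ 2) `^ alpha <= b.
  rewrite -ya ge0_ler_powR ?nnegrE ?sqr_ge0 ?(ltW y0) ?(ltW a0)//.
  apply: le_trans dd _; rewrite /d -[leRHS]invrK lef_pV2 ?posrE ?invr_gt0//.
  by apply: hN; rewrite /= ltnW.
apply: le_trans (ler_wpM2l (normr_ge0 t) xb) _.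
by rewrite /b invfM mulrCA ger_pMr ?invr_gt0// ler_pdivrMr// mul1r lerDl.
Qed.

Local Close Scope complex_scope.
Local Close Scope classical_set_scope.

Theorem proposition7p1 (R : realType) (alpha : R)
    (halpha : 0 < alpha <= 4^-1) (t : R) (ht : t != 0) :
  enorm (position (propagator t (frac_laplacian alpha) (delta R 0))) = +oo%E.
Proof.
set psi := ell2_fun (propagator _ _ _).
have [fin|] := ltP (sqnorm (position psi)) +oo%E; last first.
  by rewrite leye_eq /enorm => /eqP ->.
exfalso.
have t0 : 0 < `|t| by rewrite normr_gt0.
have a01 : 0 < alpha < 1.
  case/andP: halpha => -> /le_lt_trans; apply.
  by rewrite invf_lt1// ltr1n.
have [lU cU tU] := propagatorP a01 t.
(* The budget, in units of [|t| * e]: the eigenvalue moves by at least [1/2], the Fourier sums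
   differ by at most [1/8], and each of the two residues at the common site is at most
   [2 * 3 / 100]. *)
have c0 : 0 < `|t| / 8 by rewrite divr_gt0.
have [N1 _ hold] := half_holder fin c0.
have [N2 _ pows] := frac_power_bounds t halpha.
pose K := (maxn N1 N2).+1.
have {}hold := hold K (leq_trans (leq_maxl _ _) (leqnSn _)).
have {pows}[xlow xhigh] := pows K (leq_trans (leq_maxr _ _) (leqnSn _)).
rewrite /mkset in hold; set d : R := K%:R^-1 in hold xlow xhigh.
have d0 : 0 < d by rewrite invr_gt0 ltr0n.
have d1 : d <= 1 by rewrite invf_le1 ?ltr0n// ler1n.
have [|u [u1 ud ux]] := @circle_point R d; first by rewrite (ltW d0).
set e := Num.sqrt d in hold xlow.
have e0 : 0 < e by rewrite sqrtr_gt0.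
set y := (d ^+ 2) `^ alpha in xlow xhigh.
have eps0 : 0 < `|t| * e / 100 by rewrite divr_gt0// mulr_gt0.
have eps30 : 0 < 3 * (`|t| * e / 100) by rewrite mulr_gt0.
have [N _ /(_ N.+2) hN] := cU _ eps0.
have {}hN := hN (leq_trans (leqnSn _) (leqnSn _)).
pose z := exp_partial N.+2 (Complex 0 t * real_complex R y).
have zt : normc (Complex 0 t * real_complex R y) = `|t| * y.
  rewrite normcM normc_real ger0_norm ?powR_ge0//; congr (_ * _).
  by rewrite /normc/= expr0n add0r sqrtr_sqr.
have zlow : `|t| * e / 2 <= normc (z - 1).
  apply: le_trans (exp_partial_lower N _); last by rewrite zt.
  by rewrite zt ler_pM2r// ler_pM2l.
have Tu := approx_eigen_exp_partial a01 t N.+2 u1 ux.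
have one1 : normc (1 : R[i]) = 1 by exact: normc1.
(* At frequency [1] the Laplacian has approximate eigenvalue [0]; since [alpha > 0] the power is [0]
   too, and the partial exponential is exactly [1]. *)
have at1 : 2 - 1 - 1^-1 = real_complex R 0 :> R[i] by rewrite invr1 rmorph0; ring.
have T1 := approx_eigen_exp_partial a01 t N.+2 one1 at1.
rewrite powR0 ?rmorph0 ?mulr0 ?exp_partial0 in T1; last by case/andP: a01 => /gt_eqF ->.
have self w : normc (w - w) <= `|t| * e / 100 by rewrite subrr normc0 ltW.
have [M1 _ hM1] := approx_eigen_near hN (self _) Tu eps0.
have [M2 _ hM2] := approx_eigen_near hN (self _) T1 eps0.
pose j := (maxn M1 M2).+1.
have {}hM1 := hM1 j (leq_trans (leq_maxl _ _) (leqnSn _)).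
have {}hM2 := hM2 j (leq_trans (leq_maxr _ _) (leqnSn _)).
rewrite /mkset scale1r in hM1 hM2.
have [m [wu w1]] := common_window lU tU (ltn0Sn _) eps30 u1 one1 hM1 hM2.
rewrite -/psi -/z in wu w1.
pose s := [seq m%:Z - k%:Z | k <- index_iota 0 j].
have us : uniq s.
  rewrite map_inj_uniq ?iota_uniq// => k l /eqP.
  by rewrite (inj_eq (addrI _)) eqr_opp eqz_nat => /eqP.
have := hold s us; rewrite big_map big_mkord => sum_le.
set Su := \sum_(k < j) u ^+ k * _ in wu.
set S1 := \sum_(k < j) 1 ^+ k * _ in w1.
(* Rotating [S1] by [u ^+ m] makes the coefficient at site [m - k] equal to [u ^+ k - u ^+ m], whose
   modulus is controlled by the distance of that site from the origin. *)
have osc : normc (Su - u ^+ m * S1) <= `|t| / 8 * e.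
  apply: le_trans sum_le; rewrite /Su /S1 mulr_sumr -sumrB.
  apply: le_trans (normc_sum _ _) _; apply: ler_sum => k _.
  rewrite expr1n mul1r -mulrBl normcM mulrC ler_wpM2l ?normc_ge0//.
  by have := dist_powers k m u1; rewrite ud distnC.
have um : normc (u ^+ m) = 1 by rewrite normcX u1 expr1n.
have : normc (z - 1) <= normc (Su - z * u ^+ m) + normc (Su - u ^+ m * S1) +
    normc (S1 - 1 ^+ m).
  have -> : normc (z - 1) = normc (z * u ^+ m - u ^+ m).
    by rewrite -[normc (z - 1)]mulr1 -um -normcM mulrBl mul1r.
  have -> : z * u ^+ m - u ^+ m =
      - (Su - z * u ^+ m) + (Su - u ^+ m * S1) + u ^+ m * (S1 - 1 ^+ m).
    by rewrite expr1n; ring.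
  apply: le_trans (le_normcD _ _) _; rewrite normcM um mul1r lerD2r.
  by apply: le_trans (le_normcD _ _) _; rewrite normcN.
move=> /(le_trans zlow); have te : 0 < `|t| * e by rewrite mulr_gt0.
rewrite mulrAC in osc; rewrite leNgt => /negP; apply.
apply: le_lt_trans (lerD (lerD wu osc) w1) _.
by move: te; move: (`|t| * e) => x; clear; lra.
Qed.
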